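(* Consider the learned reverse SDE $$\mathrm{d}X_t=\left(f_tX_t+\frac{g_t^2}{\sigma_t}\epsilon_\theta(X_t,t)\right)\mathrm{d}t+g_t\,\mathrm{d}\bar W_t.$$ DDPM sampling admits two complementary interpretations. 1. It is exactly the learned reverse Gaussian chain associated with the discrete forward diffusion $q(\tilde x_k\mid\tilde x_{k-1})=\mathcal{N}(\tilde x_k;\sqrt{a_k}\,\tilde x_{k-1},(1-a_k)I)$. 2. Under the variance-preserving (VP) correspondence $\alpha_{t_k}=\sqrt{\bar a_k}$, $\sigma_{t_k}=\sqrt{1-\bar a_k}$, $a_k=e^{-h_k}$, $b_k=1-e^{-h_k}$, its conditional mean matches the conditional mean of the first-order backward Euler--Maruyama discretization of the learned reverse SDE up to $O(h_k^2)$. Its stochastic term does not coincide exactly with the Euler--Maruyama stochastic term at finite step size; instead DDPM uses the exact Gaussian posterior variance of the discrete forward diffusion. For interior steps with $1-\bar a_{k-1}>0$ fixed, the two variances agree to first order: $$\widetilde b_k=h_k+O(h_k^2).$$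
   Context: Discrete forward chain on $\mathbb{R}^d$, on a time grid $0=t_0<t_1<\cdots<t_N=1$: $q(\tilde x_k\mid\tilde x_{k-1})=\mathcal{N}(\tilde x_k;\sqrt{a_k}\,\tilde x_{k-1},(1-a_k)I)$, $k=1,\dots,N$, with $b_k\in(0,1)$, $a_k:=1-b_k$, $\bar a_k:=\prod_{i=1}^ka_i$, $\bar a_0:=1$; here $\mathcal{N}(x;m,\Sigma)$ denotes the Gaussian law with mean $m$ and covariance $\Sigma$. Equivalently $\tilde x_k=\sqrt{\bar a_k}\,\tilde x_0+\sqrt{1-\bar a_k}\,\varepsilon$ with $\varepsilon\sim\mathcal{N}(0,I)$. The exact reverse Gaussian posterior of this chain is $q(\tilde x_{k-1}\mid\tilde x_k,\tilde x_0)=\mathcal{N}\bigl(\tilde x_{k-1};\frac1{\sqrt{a_k}}\bigl(\tilde x_k-\frac{b_k}{\sqrt{1-\bar a_k}}\varepsilon\bigr),\widetilde b_kI\bigr)$ with posterior variance $\widetilde b_k:=\frac{1-\bar a_{k-1}}{1-\bar a_k}b_k$. DDPM (ancestral) sampling replaces $\varepsilon$ by a learned noise predictor: $\tilde x_N\sim\mathcal{N}(0,I)$ and, for $k=N,\dots,1$, $\tilde x_{k-1}$ is drawn from the learned reverse kernel $p_\theta(\tilde x_{k-1}\mid\tilde x_k)=\mathcal{N}\bigl(\tilde x_{k-1};\widetilde\mu_\theta(\tilde x_k,k),\widetilde b_kI\bigr)$ with $\widetilde\mu_\theta(\tilde x_k,k):=\frac1{\sqrt{a_k}}\bigl(\tilde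 x_k-\frac{b_k}{\sqrt{1-\bar a_k}}\epsilon_\theta(\tilde x_k,k)\bigr)$. Here $\epsilon_\theta(x,t)$ is the learned $\mathbb{R}^d$-valued noise predictor and $\epsilon_\theta(x,k):=\epsilon_\theta(x,t_k)$. VP correspondence: $\alpha_t,\sigma_t$ are differentiable on $[0,1]$ with $\alpha_t^2+\sigma_t^2=1$, $\alpha_{t_k}=\sqrt{\bar a_k}$, $\sigma_{t_k}=\sqrt{1-\bar a_k}$, and $X_{t_k}$ is identified with $\tilde x_k$; $\beta(t):=-2\dot\alpha_t/\alpha_t\ge0$, $f_t=-\frac12\beta(t)$, $g_t^2=\beta(t)$; and $h_k:=\int_{t_{k-1}}^{t_k}\beta(s)\,\mathrm{d}s$, which gives $a_k=e^{-h_k}$, $b_k=1-e^{-h_k}$. The learned reverse SDE is run with $t:1\to0$, and $\bar W_t=W^{\mathrm{rev}}_{1-t}$, where $W^{\mathrm{rev}}_\tau$ is a standard Brownian motion in the increasing variable $\tau=1-t$. The first-order backward Euler--Maruyama step from $t_k$ to $t_{k-1}$ integrates the SDE over the step with $X_s$, $\sigma_s$ and $\epsilon_\theta(X_s,s)$ in the drift frozen at $s=t_k$, which (up to $O(h_k^2)$) gives $\tilde x_k+\frac{h_k}2\tilde x_k-\frac{h_k}{\sqrt{1-\bar a_k}}\epsilon_\theta(\tilde x_k,k)+\sqrt{h_k}\,z_k$, $z_k\sim\mathcal{N}(0,I)$; its stochastic term has variance $h_k$ (covariance $h_kI$). *)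

(* Defs.v *)
From HB Require Import structures.
From mathcomp Require Import all_boot all_order all_algebra.
From mathcomp Require Import all_classical all_reals all_analysis.
From mathcomp Require Import measurable_realfun.

Set Implicit Arguments.
Unset Strict Implicit.
Unset Printing Implicit Defensive.

Import Order.TTheory GRing.Theory Num.Theory.
Import numFieldNormedType.Exports.

Local Open Scope classical_set_scope.
Local Open Scope ring_scope.

(* R^d is 'rV[R]_d with the product sigma-algebra of the coordinates, which for
   finite d is the Borel sigma-algebra. *)
Definition coord (R : realType) (d : nat) (i : 'I_d) (x : 'rV[R]_d) : R :=
  x ord0 i.

Definition row_vector_display : measure_display.
Proof. exact: default_measure_display. Qed.

Section measurable_row_vector.
Variables (R : realType) (d : nat).

Let rv_set0 : g_sigma_preimage (@coord R d) set0.
Proof. exact: sigma_algebra0. Qed.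

Let rv_setC A :
  g_sigma_preimage (@coord R d) A -> g_sigma_preimage (@coord R d) (~` A).
Proof. exact: sigma_algebraC. Qed.

Let rv_bigcup (F : (set 'rV[R]_d)^nat) :
  (forall i, g_sigma_preimage (@coord R d) (F i)) ->
  g_sigma_preimage (@coord R d) (\bigcup_i (F i)).
Proof. exact: sigma_algebra_bigcup. Qed.

HB.instance Definition _ := @isMeasurable.Build row_vector_display 'rV[R]_d
  (g_sigma_preimage (@coord R d)) rv_set0 rv_setC rv_bigcup.

End measurable_row_vector.

Lemma measurable_coord (R : realType) (d : nat) (i : 'I_d) :
  measurable_fun [set: 'rV[R]_d] (@coord R d i).
Proof.
move=> _ Y mY; rewrite setTI; apply: sub_sigma_algebra => /=.
rewrite -bigcup_seq/=; exists i => /=; first by rewrite mem_index_enum.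
by exists Y => //; rewrite setTI.
Qed.

Lemma measurable_fun_coordP (R : realType) (d : nat) (d1 : measure_display)
    (T : measurableType d1) (f : T -> 'rV[R]_d) :
  (forall i, measurable_fun [set: T] (fun t => coord i (f t))) ->
  measurable_fun [set: T] f.
Proof.
move=> mf; apply: (measurability (\big[setU/set0]_(i < d)
  preimage_set_system setT (@coord R d i) measurable)) => //.
move=> _ [A + <-]; rewrite -bigcup_seq/= => -[i _ [B mB <-]].
by rewrite setTI; apply: mf.
Qed.

Section isotropic_gaussian.
Variable R : realType.

Definition cons_row (d : nat) (p : measurableTypeR R * 'rV[R]_d) :
    'rV[R]_d.+1 :=
  row_mx (const_mx (p.1 : R) : 'rV[R]_1) p.2.

Lemma measurable_cons_row (d : nat) : measurable_fun setT (@cons_row d).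
Proof.
apply: measurable_fun_coordP => i; rewrite -[i](@splitK 1 d).
case: (fintype.split _) => j.
  rewrite (_ : (fun _ => _) = fst); first exact: measurable_fst.
  by apply/funext => p; rewrite /coord /cons_row [LHS]row_mxEl mxE.
rewrite (_ : (fun _ => _) = coord j \o snd); last first.
  by apply/funext => p; rewrite /coord /cons_row [LHS]row_mxEr.
by apply: measurableT_comp; [exact: measurable_coord|exact: measurable_snd].
Qed.

HB.instance Definition _ (d : nat) := isMeasurableFun.Build _ _
  _ _ (@cons_row d) (@measurable_cons_row d).

(* N(0, I_d), as the d-fold product of N(0, 1). *)
Fixpoint std_gauss (d : nat) : probability 'rV[R]_d R :=
  match d with
  | 0 => \d_(0 : 'rV[R]_0)
  | d'.+1 => distribution (normal_prob 0 1 \x std_gauss d')%E (@cons_row d')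
  end.

Definition shift_scale (d : nat) (m : 'rV[R]_d) (s : R) (z : 'rV[R]_d) :
  'rV[R]_d := m + s *: z.

Lemma measurable_shift_scale (d : nat) (m : 'rV[R]_d) (s : R) :
  measurable_fun setT (shift_scale m s).
Proof.
apply: measurable_fun_coordP => i; rewrite /coord /shift_scale.
under eq_fun do rewrite !mxE.
apply: measurable_funD => //; apply: measurable_funM => //.
exact: measurable_coord.
Qed.

HB.instance Definition _ (d : nat) (m : 'rV[R]_d) (s : R) :=
  isMeasurableFun.Build _ _ 'rV[R]_d 'rV[R]_d (shift_scale m s)
    (measurable_shift_scale m s).

(* N(m, v I_d) for v >= 0; it is the Dirac mass at m when v = 0. *)
Definition gauss (d : nat) (m : 'rV[R]_d) (v : R) : probability 'rV[R]_d R :=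
  distribution (std_gauss d) (shift_scale m (Num.sqrt v)).

End isotropic_gaussian.

Section random_vectors.
Context {R : realType} {d : nat} {dO : measure_display}
  {Omega : measurableType dO}.
Variable P : probability Omega R.

Definition sigma_gen {I : Type} (X : I -> Omega -> 'rV[R]_d) (J : set I) :
    set (set Omega) :=
  <<s \bigcup_(j in J) preimage_set_system setT (X j) measurable >>.

(* kappa is a regular conditional distribution of Y given the sigma-algebra G *)
Definition is_cond_law (G : set (set Omega)) (Y : Omega -> 'rV[R]_d)
    (kappa : Omega -> probability 'rV[R]_d R) : Prop :=
  (forall (B : set 'rV[R]_d) (U : set (\bar R)),
     measurable B -> measurable U -> G [set w | U (kappa w B)]) /\
  (forall (E : set Omega) (B : set 'rV[R]_d), G E -> measurable B ->
     P (E `&` Y @^-1` B) = \int[P]_(w in E) kappa w B)%E.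

Definition mean_vec (Y : Omega -> 'rV[R]_d) : 'rV[R]_d :=
  \row_i fine 'E_P[(fun w => Y w ord0 i)]%E.

Definition cov_mx (Y : Omega -> 'rV[R]_d) : 'M[R]_d :=
  \matrix_(i, j) fine (covariance P (fun w => Y w ord0 i)
                                    (fun w => Y w ord0 j)).

(* Standard d-dimensional Brownian motion on the time set [0, +oo[; the values
   of W at negative times are irrelevant. *)
Definition brownian_motion (W : R -> Omega -> 'rV[R]_d) : Prop :=
  [/\ forall u, 0 <= u -> measurable_fun setT (W u),
      {ae P, forall w, W 0 w = 0},
      forall s u, 0 <= s -> s < u ->
        is_cond_law (sigma_gen W [set r | 0 <= r <= s])
          (fun w => W u w - W s w) (fun=> gauss 0 (u - s)) &
      {ae P, forall w, {within `[0, +oo[, continuous (fun u => W u w)}}].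

Definition step_fun (n : nat) (s c : nat -> R) (u : R) : R :=
  \sum_(i < n) c i * \1_(`]s i, s i.+1]) u.

Definition step_integral (W : R -> Omega -> 'rV[R]_d) (n : nat) (s c : nat -> R)
    (w : Omega) : 'rV[R]_d :=
  \sum_(i < n) c i *: (W (s i.+1) w - W (s i) w).

(* I is (a version of) the Wiener integral of the deterministic integrand phi
   over [a, b] against W: the L^2(P) limit of the integrals of step functions
   that converge to phi in L^2([a, b]). *)
Definition is_wiener_integral (W : R -> Omega -> 'rV[R]_d) (phi : R -> R)
    (a b : R) (I : Omega -> 'rV[R]_d) : Prop :=
  [/\ measurable_fun `[a, b] phi, measurable_fun setT I &
   exists (n : nat -> nat) (s c : nat -> nat -> R),
   [/\ forall m, [/\ s m 0%N = a, s m (n m) = b &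
                     forall i, (i < n m)%N -> s m i <= s m i.+1],
       (\int[lebesgue_measure]_(u in `[a, b])
          ((phi u - step_fun (n m) (s m) (c m) u) ^+ 2)%:E)%E
         @[m --> \oo] --> 0%E &
       forall j, (\int[P]_w
          ((I w ord0 j - step_integral W (n m) (s m) (c m) w ord0 j) ^+ 2)%:E)%E
         @[m --> \oo] --> 0%E]].

End random_vectors.

Record schedule (R : realType) := Schedule {
  nsteps : nat;
  tgrid : nat -> R;
  bcoef : nat -> R;
  tgrid0 : tgrid 0 = 0;
  tgridN : tgrid nsteps = 1;
  tgrid_lt : forall k, (k < nsteps)%N -> tgrid k < tgrid k.+1;
  bcoef_itv : forall k, (0 < k <= nsteps)%N -> 0 < bcoef k < 1 }.

Section diffusion_chain.
Variables (R : realType) (d : nat) (S : schedule R).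

Definition acoef (k : nat) : R := 1 - bcoef S k.

Definition abar (k : nat) : R := \prod_(1 <= i < k.+1) acoef i.

Definition btilde (k : nat) : R :=
  (1 - abar k.-1) / (1 - abar k) * bcoef S k.

Definition forward_chain (dO : measure_display) (Omega : measurableType dO)
    (P : probability Omega R) (X : nat -> Omega -> 'rV[R]_d) : Prop :=
  (forall k, (k <= nsteps S)%N -> measurable_fun setT (X k)) /\
  (forall k, (0 < k <= nsteps S)%N ->
     is_cond_law P (sigma_gen X [set j | (j < k)%N]) (X k)
       (fun w => gauss (Num.sqrt (acoef k) *: X k.-1 w) (1 - acoef k))).

(* the eps solving x = sqrt(abar_k) x0 + sqrt(1 - abar_k) eps *)
Definition noise_of (k : nat) (x x0 : 'rV[R]_d) : 'rV[R]_d :=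
  (Num.sqrt (1 - abar k))^-1 *: (x - Num.sqrt (abar k) *: x0).

(* q(x_{k-1} | x_k = x, x_0 = x0) *)
Definition posterior (k : nat) (x x0 : 'rV[R]_d) : probability 'rV[R]_d R :=
  gauss ((Num.sqrt (acoef k))^-1 *:
           (x - (bcoef S k / Num.sqrt (1 - abar k)) *: noise_of k x x0))
        (btilde k).

Variable eps : 'rV[R]_d -> R -> 'rV[R]_d.

Definition ddpm_mean (k : nat) (x : 'rV[R]_d) : 'rV[R]_d :=
  (Num.sqrt (acoef k))^-1 *:
    (x - (bcoef S k / Num.sqrt (1 - abar k)) *: eps x (tgrid S k)).

Definition ddpm_kernel (k : nat) (x : 'rV[R]_d) : probability 'rV[R]_d R :=
  gauss (ddpm_mean k x) (btilde k).

(* the x0 whose noise, given x_k = x, is the predicted one: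
   noise_of k x (predicted_clean k x) = eps x (tgrid S k) *)
Definition predicted_clean (k : nat) (x : 'rV[R]_d) : 'rV[R]_d :=
  (Num.sqrt (abar k))^-1 *: (x - Num.sqrt (1 - abar k) *: eps x (tgrid S k)).

Definition reverse_chain
    (kappa : nat -> 'rV[R]_d -> probability 'rV[R]_d R)
    (dO : measure_display) (Omega : measurableType dO)
    (P : probability Omega R) (X : nat -> Omega -> 'rV[R]_d) : Prop :=
  [/\ forall k, (k <= nsteps S)%N -> measurable_fun setT (X k),
      forall B, measurable B -> P (X (nsteps S) @^-1` B) = gauss 0 1 B &
      forall k, (0 < k <= nsteps S)%N ->
        is_cond_law P (sigma_gen X [set j | (k <= j <= nsteps S)%N])
          (X k.-1) (fun w => kappa k (X k w))].

Definition ddpm_sampling := reverse_chain ddpm_kernel.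

(* the forward posterior with its noise replaced by the predictor *)
Definition learned_reverse_chain :=
  reverse_chain (fun k x => posterior k x (predicted_clean k x)).

End diffusion_chain.

Section vp_correspondence.
Variable R : realType.

(* Derivatives of functions on [0, 1], one-sided at the end points. *)
Definition diff_quot (f : R -> R) (u v : R) : R := (f v - f u) / (v - u).

Definition derivable01 (f : R -> R) (u : R) : Prop :=
  cvg (diff_quot f u v @[v --> within `[0, 1] u^']).

Definition deriv01 (f : R -> R) (u : R) : R :=
  lim (diff_quot f u v @[v --> within `[0, 1] u^']).

Definition beta (alpha : R -> R) (u : R) : R :=
  - 2 * deriv01 alpha u / alpha u.

Definition hstep (S : schedule R) (alpha : R -> R) (k : nat) : R :=
  \int[lebesgue_measure]_(u in `[tgrid S k.-1, tgrid S k]) beta alpha u.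

Record vp_corr (S : schedule R) (alpha sigma f g : R -> R) : Prop := VPCorr {
  vp_diff : forall u, 0 <= u <= 1 -> derivable01 alpha u /\ derivable01 sigma u;
  vp_sqr : forall u, 0 <= u <= 1 -> alpha u ^+ 2 + sigma u ^+ 2 = 1;
  vp_alpha : forall k, (k <= nsteps S)%N ->
    alpha (tgrid S k) = Num.sqrt (abar S k);
  vp_sigma : forall k, (k <= nsteps S)%N ->
    sigma (tgrid S k) = Num.sqrt (1 - abar S k);
  vp_beta : forall u, 0 <= u <= 1 -> 0 <= beta alpha u;
  vp_f : forall u, 0 <= u <= 1 -> f u = - (1 / 2) * beta alpha u;
  vp_g : forall u, 0 <= u <= 1 -> g u ^+ 2 = beta alpha u;
  vp_a : forall k, (0 < k <= nsteps S)%N ->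
    acoef S k = expR (- hstep S alpha k);
  vp_b : forall k, (0 < k <= nsteps S)%N ->
    bcoef S k = 1 - expR (- hstep S alpha k) }.

Variable d : nat.

(* The drift of the learned reverse SDE at (x, t) is [rev_drift f g sigma eps t
   t x]. The separate time u allows the state, sigma and eps to be frozen at u
   while the coefficients f_s and g_s^2 keep running. *)
Definition rev_drift (f g sigma : R -> R) (eps : 'rV[R]_d -> R -> 'rV[R]_d)
    (s u : R) (x : 'rV[R]_d) : 'rV[R]_d :=
  f s *: x + (g s ^+ 2 / sigma u) *: eps x u.

(* I is the stochastic term of the step from t_k to t_{k-1}: the integral of
   g_t against bar W_t = W_{1-t}, written in the increasing time tau = 1 - t. *)
Definition em_noise (S : schedule R) (g : R -> R) (k : nat)
    (dO : measure_display) (Omega : measurableType dO) (P : probability Omega R)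
    (W : R -> Omega -> 'rV[R]_d) (I : Omega -> 'rV[R]_d) : Prop :=
  is_wiener_integral P W (fun tau => g (1 - tau))
    (1 - tgrid S k) (1 - tgrid S k.-1) I.

(* The backward Euler-Maruyama step started from x at t_k. The drift carries a
   minus sign because time runs from t_k down to t_{k-1}. *)
Definition em_step (S : schedule R) (f g sigma : R -> R)
    (eps : 'rV[R]_d -> R -> 'rV[R]_d) (k : nat) (x : 'rV[R]_d)
    (Omega : Type) (I : Omega -> 'rV[R]_d) (w : Omega) : 'rV[R]_d :=
  x - (\row_i \int[lebesgue_measure]_(s in `[tgrid S k.-1, tgrid S k])
         rev_drift f g sigma eps s (tgrid S k) x ord0 i) + I w.

End vp_correspondence.

(* Main.v *)
Require Import Defs.
From HB Require Import structures.
From mathcomp Require Import all_boot all_order all_algebra.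
From mathcomp Require Import all_classical all_reals all_analysis.
From mathcomp Require Import measurable_realfun ring lra.

Set Implicit Arguments.
Unset Strict Implicit.
Unset Printing Implicit Defensive.

Import Order.TTheory GRing.Theory Num.Theory.
Import numFieldNormedType.Exports.

Local Open Scope classical_set_scope.
Local Open Scope ring_scope.

(** The forward chain is Gaussian given its start: inductively, the law of
    (x_0, x_j) is that of (x_0, sqrt(abar_j) x_0 + sqrt(1 - abar_j) z) with z
    standard Gaussian. One more step adds an independent Gaussian, and the
    orthogonal reflection (z_1, z_2) |-> (c z_1 + s z_2, s z_1 - c z_2), which
    preserves the product of two standard Gaussians, turns the pair
    (x_{k-1}, x_k) into a pair driven by the noise of x_k and a noise that is
    independent of it: this is the posterior. Replacing the noise by eps gives
    the DDPM kernel.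

    For the Euler-Maruyama step only the first two moments of the stochastic
    term matter. They are computed for integrals of step functions, where the
    increments are independent, and pass to the L^2 limit by polarization; the
    variance is the integral of beta over the step, that is h. Everything then
    reduces to estimates of exponentials. At finite step size btilde <= b =
    1 - exp(-h) < h, so the two noises have different laws. *)

(** * Densities, affine substitutions and product measures *)

(** Bayes' formula with densities does not give the posterior in general: the law of x_0 is
    arbitrary, and at the first step btilde = 0, so that the posterior is a Dirac mass. The
    reflection involves the noises only and covers this step too. It is found by writing sqrt(a)
    sqrt(1 - abar) z_1 + sqrt(b) z_2 as sqrt(1 - abar') (c z_1 + s z_2), with abar' the next
    product; the second component is then the part of the noise that x_k does not see.

    A conditional law is defined by a test on events, that is, on rectangles for the joint law. All
    substitutions are therefore made in iterated integrals of nonnegative measurable functions, to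
    which the test extends without any integrability condition.

    Equal laws have equal covariances, so a difference of variances separates the noises as soon as
    there is a diagonal entry to read, which is where d > 0 enters. *)

Definition mfun_of d1 d2 (T1 : measurableType d1) (T2 : measurableType d2)
    (f : T1 -> T2) (mf : measurable_fun setT f) : {mfun T1 >-> T2} :=
  HB.pack f (isMeasurableFun.Build _ _ _ _ f mf).

Section density.
Local Open Scope ereal_scope.
Context d (T : measurableType d) (R : realType).
Variables (mu nu : {measure set T -> \bar R}) (p : T -> R).
Hypotheses (p0 : forall x, (0 <= p x)%R) (mp : measurable_fun setT p).
Hypothesis nuE : forall A, measurable A -> nu A = \int[mu]_(x in A) (p x)%:E.

Import HBNNSimple.

(** [nuE] is the case of indicators. Splitting along the finitely many values gives simple
    functions, and monotone convergence the rest. *)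
Lemma ge0_integral_density (f : T -> \bar R) :
  measurable_fun setT f -> (forall x, 0 <= f x) ->
  \int[nu]_x f x = \int[mu]_x (f x * (p x)%:E).
Proof.
move=> mf f0; pose f_ := nnsfun_approx measurableT mf.
have mpE : measurable_fun setT (EFin \o p) by exact/measurable_EFinP.
have mulp n : measurable_fun setT (fun x => (f_ n x)%:E * (p x)%:E).
  by apply: emeasurable_funM => //; exact/measurable_EFinP.
transitivity (limn (fun n => \int[nu]_x (f_ n x)%:E)).
  rewrite -monotone_convergence//.
  - apply: eq_integral => y _; apply/esym/cvg_lim => //.
    by apply: cvg_nnsfun_approx => // *; exact: f0.
  - by move=> n; exact/measurable_EFinP/measurable_funP.
  - by move=> n y _; rewrite lee_fin.
  - by move=> y _ m n mn; rewrite lee_fin; exact/lefP/nd_nnsfun_approx.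
transitivity (limn (fun n => \int[mu]_x ((f_ n x)%:E * (p x)%:E))); last first.
  rewrite -monotone_convergence//.
  - apply: eq_integral => y _; apply/cvg_lim => //.
    apply: cvgeZr => //.
    by apply: cvg_nnsfun_approx => // *; exact: f0.
  - by move=> n y _; rewrite mule_ge0 ?lee_fin.
  - move=> y _ m n mn; rewrite lee_pmul ?lee_fin//.
    exact/lefP/nd_nnsfun_approx.
congr (limn _); apply/funext => n.
transitivity (\sum_(k \in range (f_ n))
    \int[nu]_x (k * \1_(f_ n @^-1` [set k]) x)%:E).
  under eq_integral do rewrite fimfunE -fsumEFin//.
  rewrite ge0_integral_fsum//.
  - by move=> y; exact/measurable_EFinP/measurable_funM.
  - by move=> y x _; rewrite nnfun_muleindic_ge0.
transitivity (\sum_(k \in range (f_ n))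
    \int[mu]_x ((k * \1_(f_ n @^-1` [set k]) x)%:E * (p x)%:E)); last first.
  rewrite -ge0_integral_fsum//.
  - apply: eq_integral => x _; rewrite [in RHS]fimfunE -fsumEFin//.
    rewrite ge0_mule_fsuml// => k.
    exact: (nnfun_muleindic_ge0 (f_ n)).
  - move=> y; apply: emeasurable_funM => //.
    exact/measurable_EFinP/measurable_funM.
  - move=> y x _; rewrite mule_ge0 ?lee_fin//.
    exact: (nnfun_muleindic_ge0 (f_ n)).
apply: eq_fsbigr => k /[!inE] -[x0 _ fk].
have k0 : (0 <= k)%R by rewrite -fk.
under eq_integral do rewrite EFinM.
rewrite ge0_integralZl//; last exact/measurable_EFinP/measurable_indic.
rewrite integral_indic// setIT nuE//.
under [RHS]eq_integral do rewrite EFinM -muleA.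
rewrite ge0_integralZl//; last first.
- by move=> x _; rewrite mule_ge0 ?lee_fin.
- by apply: emeasurable_funM => //; exact/measurable_EFinP/measurable_indic.
congr (_ * _); rewrite integral_mkcond; apply: eq_integral => x _.
rewrite patchE indicE; case: ifPn => _ /=; by rewrite ?mul1e ?mul0e.
Qed.

End density.

Section lebesgue_affine.
Context {R : realType}.
Local Notation mu := (@lebesgue_measure R).

(** By uniqueness of Lebesgue measure it suffices to measure half-open intervals. A negative slope
    exchanges the open and the closed end, which does not affect the length. *)
Lemma lebesgue_measure_affine (a b : R) (A : set (measurableTypeR R)) :
  a != 0 -> measurable A ->
  (mu A = `|a|%:E * mu ((fun x => a * x + b)%R @^-1` A))%E.
Proof.
move=> a0 mA.
have mf : measurable_fun [set: measurableTypeR R]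
    (fun x : measurableTypeR R => (a * x + b)%R : measurableTypeR R).
  by apply: measurable_funD => //; exact: measurable_funM.
pose m1 : {measure set _ -> \bar R} :=
  measure_function_pushforward__canonical__measure_function_Measure mu mf.
pose m2 : {measure set _ -> \bar R} := mscale (NngNum (normr_ge0 a)) m1.
rewrite -[RHS]/(m2 A); apply: lebesgue_measure_unique => //= _ [[x y]] _ <-.
rewrite /m2 /mscale/= /m1 /pushforward/=.
have [a_lt0|a_gt0|aE] := ltgtP a 0; last by rewrite aE eqxx in a0.
- rewrite [X in (_ * mu X)%E](_ : _ = `[(y - b) / a, (x - b) / a[%classic).
    rewrite !lebesgue_measure_itv/= !lte_fin.
    rewrite ltr_nM2r ?invr_lt0// ltrD2r; case: ifPn => // _; last by rewrite mule0.
    by rewrite -!EFinD -EFinM ltr0_norm//; congr EFin; field.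
  apply/seteqP; split => z/=; rewrite !in_itv/= ler_ndivrMr//  ltr_ndivlMr//.
    by move=> /andP[]; rewrite mulrC; lra.
  by move=> /andP[]; rewrite mulrC; lra.
- rewrite [X in (_ * mu X)%E](_ : _ = `](x - b) / a, (y - b) / a]%classic).
    rewrite !lebesgue_measure_itv/= !lte_fin.
    rewrite ltr_pM2r ?invr_gt0// ltrD2r; case: ifPn => // _; last by rewrite mule0.
    by rewrite -!EFinD -EFinM gtr0_norm//; congr EFin; field.
  apply/seteqP; split => z/=; rewrite !in_itv/= ltr_pdivrMr// ler_pdivlMr//.
    by move=> /andP[]; rewrite mulrC; lra.
  by move=> /andP[]; rewrite mulrC; lra.
Qed.

Lemma ge0_integral_affine (a b : R) (D : set R) (f : R -> \bar R) :
  a != 0 -> measurable D -> measurable_fun D f -> (forall x, D x -> 0 <= f x)%E ->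
  (\int[mu]_(x in D) f x =
   `|a|%:E * \int[mu]_(x in (fun x => a * x + b)%R @^-1` D) f (a * x + b)%R)%E.
Proof.
move=> a0 mD mf f0.
have ma : measurable_fun [set: measurableTypeR R]
    (fun x : measurableTypeR R => (a * x + b)%R : measurableTypeR R).
  by apply: measurable_funD => //; exact: measurable_funM.
pose m1 : {measure set _ -> \bar R} :=
  measure_function_pushforward__canonical__measure_function_Measure mu ma.
pose m2 : {measure set _ -> \bar R} := mscale (NngNum (normr_ge0 a)) m1.
transitivity (\int[m2]_(x in D) f x)%E.
  by apply: eq_measure_integral => /= A mA _; exact: lebesgue_measure_affine.
rewrite ge0_integral_mscale//=; congr (_ * _)%E.
by rewrite ge0_integral_pushforward// => x /[!inE]; exact: f0.
Qed.

End lebesgue_affine.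

Section products.
Local Open Scope ereal_scope.
Context d1 d2 (T1 : measurableType d1) (T2 : measurableType d2) (R : realType).

(** Rectangles are stable under intersection and generate the product sigma-algebra. As the measures
    are finite, the constant sequence [setT] serves as exhaustion. *)
Lemma eq_measure_rectangles
    (m1 m2 : {finite_measure set (T1 * T2)%type -> \bar R}) :
  (forall A B, measurable A -> measurable B -> m1 (A `*` B) = m2 (A `*` B)) ->
  forall X, measurable X -> m1 X = m2 X.
Proof.
move=> m12.
pose C : set (set (T1 * T2)) := [set A `*` B | A in measurable & B in measurable].
move=> X mX; apply: (measure_unique C (fun=> setT)) => //.
- by rewrite measurable_prod_measurableType.
- move=> _ _ [A1 mA1 [B1 mB1 <-]] [A2 mA2 [B2 mB2 <-]].
  exists (A1 `&` A2); first exact: measurableI.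
  by exists (B1 `&` B2); [exact: measurableI|rewrite setXI].
- by move=> _; exists setT => //; exists setT => //; rewrite setXTT.
- by rewrite bigcup_const//; exists 0%N.
- by move=> _ [A mA [B mB <-]]; exact: m12.
- move=> _; exact: fin_num_fun_lty.
Qed.

Variables (m1 : probability T1 R) (m2 : probability T2 R).

Lemma ge0_integral_prodM (f : T1 -> \bar R) (g : T2 -> \bar R) :
  measurable_fun setT f -> measurable_fun setT g ->
  (forall x, 0 <= f x) -> (forall y, 0 <= g y) ->
  \int[m1 \x m2]_z (f z.1 * g z.2) = \int[m1]_x f x * \int[m2]_y g y.
Proof.
move=> mf mg f0 g0; rewrite fubini_tonelli1//=; last 2 first.
- by apply: emeasurable_funM; apply: measurableT_comp.
- by move=> z; rewrite mule_ge0.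
transitivity (\int[m1]_x (f x * \int[m2]_y g y)).
  by apply: eq_integral => x _; rewrite /fubini_F/= ge0_integralZl.
by rewrite ge0_integralZr// integral_ge0.
Qed.

Lemma integral_prodM (f : T1 -> R) (g : T2 -> R) :
  m1.-integrable setT (EFin \o f) -> m2.-integrable setT (EFin \o g) ->
  (m1 \x m2).-integrable setT (fun z => (f z.1 * g z.2)%:E) /\
  \int[m1 \x m2]_z (f z.1 * g z.2)%:E =
  \int[m1]_x (f x)%:E * \int[m2]_y (g y)%:E.
Proof.
move=> intf intg.
have mf := measurable_int _ intf; have mg := measurable_int _ intg.
have int : (m1 \x m2).-integrable setT (fun z => (f z.1 * g z.2)%:E).
  apply/integrableP; split.
    under eq_fun do rewrite EFinM.
    apply: emeasurable_funM.
      exact: (measurableT_comp mf measurable_fst).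
    exact: (measurableT_comp mg measurable_snd).
  under eq_integral do rewrite EFinM abseM.
  rewrite (ge0_integral_prodM (f := fun x => `|(f x)%:E|)
    (g := fun y => `|(g y)%:E|))//; last 2 first.
  - exact: measurableT_comp.
  - exact: measurableT_comp.
  by rewrite lte_mul_pinfty ?integral_ge0 ?ge0_fin_numE ?integral_ge0//; 
     [case/integrableP: intf|case/integrableP: intg].
split => //; rewrite -integral12_prod_meas1//.
transitivity (\int[m1]_x ((f x)%:E * \int[m2]_y (g y)%:E)).
  apply: eq_integral => x _; rewrite /fubini_F/=.
  by under eq_integral do rewrite EFinM; rewrite integralZl.
have /fineK <- := integrable_fin_num measurableT intg.
by rewrite integralZr.
Qed.

End products.

(** * Invariance of Gaussian pairs under reflections *)

Section reflection.
Context {R : realType}.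
Local Notation mu := (@lebesgue_measure R).
Variables c s : R.
Hypotheses (s0 : 0 < s) (cs : c ^+ 2 + s ^+ 2 = 1).

(* Two substitutions: u = c x + s y for y, then v = (x - c u) / s for x. Only s
   is divided by, so that c = 0 is allowed: this happens at the first step of
   the chain, where 1 - abar_0 = 0. *)
Lemma ge0_integral_lebesgue_reflection (K : R * R -> \bar R) :
  measurable_fun setT K -> (forall z, 0 <= K z)%E ->
  (\int[mu]_x \int[mu]_y K (c * x + s * y, s * x - c * y)%R =
   \int[mu]_x \int[mu]_y K (x, y))%E.
Proof.
move=> mK K0.
have mL : measurable_fun [set: R * R]
    (fun z => K (z.2, s^-1 * z.1 - c / s * z.2)).
  apply: measurableT_comp => //; apply: measurable_fun_pair => //.
  by apply: measurable_funB; apply: measurable_funM.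
transitivity (\int[mu]_x ((s^-1)%:E *
    \int[mu]_u K (u, s^-1 * x - c / s * u)%R))%E.
  apply: eq_integral => x _.
  rewrite [in RHS](@ge0_integral_affine _ s (c * x))//; last 2 first.
  - by rewrite gt_eqF.
  - exact: (measurableT_comp mL (pair1_measurable x)).
  rewrite preimage_setT muleA gtr0_norm// -EFinM mulVf ?gt_eqF// mul1e.
  apply: eq_integral => y _; congr (K (_, _)); first by rewrite addrC.
  have -> : s^-1 * x - c / s * (s * y + c * x) =
      s^-1 * (1 - c ^+ 2) * x - c * y by field; rewrite gt_eqF.
  have -> : 1 - c ^+ 2 = s ^+ 2 by rewrite -cs; ring.
  by field; rewrite gt_eqF.
rewrite ge0_integralZl//; last 3 first.
- by apply: (measurable_fun_fubini_tonelli_F (m2 := mu)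
    (fun z => K (z.2, s^-1 * z.1 - c / s * z.2)%R)).
- by move=> x _; exact: integral_ge0.
- by rewrite lee_fin invr_ge0 ltW.
have /= -> // := fubini_tonelli (m1 := mu) (m2 := mu)
  (fun z => K (z.2, s^-1 * z.1 - c / s * z.2)%R).
rewrite -ge0_integralZl//; last 3 first.
- by apply: (measurable_fun_fubini_tonelli_G (m1 := mu)
    (fun z => K (z.2, s^-1 * z.1 - c / s * z.2)%R)).
- by move=> x _; exact: integral_ge0.
- by rewrite lee_fin invr_ge0 ltW.
apply: eq_integral => u _.
rewrite [in RHS](@ge0_integral_affine _ s^-1 (- (c / s * u)))//; last 2 first.
- by rewrite invr_eq0 gt_eqF.
- exact: (measurableT_comp mK (pair1_measurable u)).
by rewrite preimage_setT gtr0_norm ?invr_gt0.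
Qed.

Lemma integral_normal_prob01 (f : R -> \bar R) :
  measurable_fun setT f -> (forall x, 0 <= f x)%E ->
  (\int[normal_prob 0 1]_x f x = \int[mu]_x (f x * (normal_pdf 0 1 x)%:E))%E.
Proof.
move=> mf f0; apply: ge0_integral_density => //.
- by move=> x; exact: normal_pdf_ge0.
- exact: measurable_normal_pdf.
Qed.

(** The product density depends only on x^2 + y^2, which an orthogonal map preserves. *)
Lemma normal_pdf_reflection (x y : R) :
  normal_pdf 0 1 (c * x + s * y) * normal_pdf 0 1 (s * x - c * y) =
  normal_pdf 0 1 x * normal_pdf 0 1 y.
Proof.
rewrite normal_pdfE ?oner_eq0// mulrACA [RHS]mulrACA; congr (_ * _).
rewrite /normal_fun -!expRD !subr0 expr1n; congr expR.
rewrite -!mulrDl; congr (_ / _).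
transitivity (- ((c ^+ 2 + s ^+ 2) * (x ^+ 2 + y ^+ 2))); first by ring.
by rewrite cs; ring.
Qed.

Lemma normal_prob2_reflection (X : set (R * R)) : measurable X ->
  ((normal_prob 0 1 \x normal_prob 0 1)
     ((fun z : R * R => (c * z.1 + s * z.2, s * z.1 - c * z.2)%R) @^-1` X) =
   (normal_prob 0 1 \x normal_prob 0 1) X)%E.
Proof.
move=> mX.
pose p (z : R * R) := normal_pdf 0 1 z.1 * normal_pdf 0 1 z.2.
have mp : measurable_fun setT p.
  by apply: measurable_funM; (apply: measurableT_comp;
    [exact: measurable_normal_pdf|]).
have p0 z : 0 <= p z by rewrite mulr_ge0 ?normal_pdf_ge0.
(* The product law gets the density [p] with respect to planar Lebesgue measure, one factor at a
   time; the Lebesgue substitution then applies. *)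
have key (Y : set (R * R)) : measurable Y ->
    ((normal_prob 0 1 \x normal_prob 0 1) Y =
    \int[mu]_x \int[mu]_y (\1_Y (x, y) * p (x, y))%:E)%E.
  move=> mY.
  have mK : measurable_fun setT (fun z : R * R => (\1_Y z * p z)%:E).
    by apply/measurable_EFinP/measurable_funM.
  have mI : measurable_fun setT (fun z : R * R => (\1_Y z : R)%:E).
    exact/measurable_EFinP/measurable_indic.
  transitivity (\int[normal_prob 0 1]_x \int[normal_prob 0 1]_y
      (\1_Y (x, y) : R)%:E)%E.
    have := fubini_tonelli1 (m1 := normal_prob 0 1) (m2 := normal_prob 0 1)
      (fun z => (\1_Y z : R)%:E).
    rewrite integral_indic// setIT => -> // z; by rewrite lee_fin.
  rewrite integral_normal_prob01//; last 2 first.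
  - by apply: (measurable_fun_fubini_tonelli_F (m2 := normal_prob 0 1)
      (fun z => (\1_Y z : R)%:E)).
  - by move=> x; apply: integral_ge0 => y _; rewrite lee_fin.
  apply: eq_integral => x _.
  rewrite integral_normal_prob01//; last first.
    exact: (measurableT_comp mI (pair1_measurable x)).
  rewrite -ge0_integralZr//.
  - by apply: eq_integral => y _; rewrite -!EFinM -mulrA [X in _ * X]mulrC.
  - apply: emeasurable_funM.
      exact: (measurableT_comp mI (pair1_measurable x)).
    by apply/measurable_EFinP; exact: measurable_normal_pdf.
  - by move=> y _; rewrite mule_ge0 ?lee_fin ?normal_pdf_ge0.
  - by rewrite lee_fin normal_pdf_ge0.
rewrite !key//; last first.
  rewrite -[X in measurable X]setTI.
  apply: (measurable_fun_pair _ _ measurableT mX).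
    by apply: measurable_funD; apply: measurable_funM.
  by apply: measurable_funB; apply: measurable_funM.
rewrite -(@ge0_integral_lebesgue_reflection (fun z => (\1_X z * p z)%:E)).
- apply: eq_integral => x _; apply: eq_integral => y _.
  by rewrite /p/= normal_pdf_reflection.
- by apply/measurable_EFinP/measurable_funM.
- by move=> z; rewrite lee_fin mulr_ge0.
Qed.

End reflection.

(** This brings the first coordinates of two independent Gaussian vectors together, so that the
    reflection can act on them separately from the remaining ones. *)
Lemma product_measure_swap d1 d2 (T1 : measurableType d1)
    (T2 : measurableType d2) (R : realType)
    (m1 : probability T1 R) (m2 : probability T2 R)
    (X : set ((T1 * T2) * (T1 * T2))) : measurable X ->
  (((m1 \x m2) \x (m1 \x m2)) X =
   ((m1 \x m1) \x (m2 \x m2))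
     ((fun z : (T1 * T1) * (T2 * T2) =>
         ((z.1.1, z.2.1), (z.1.2, z.2.2))) @^-1` X))%E.
Proof.
set J := fun z : (T1 * T1) * (T2 * T2) => _.
have mJ : measurable_fun setT J.
  apply: measurable_fun_pair; apply: measurable_fun_pair;
  by do ?apply: measurableT_comp.
pose P1 : probability ((T1 * T1) * (T2 * T2))%type R :=
  ((m1 \x m1) \x (m2 \x m2))%E.
move=> mX; rewrite -[RHS]/(distribution P1 (mfun_of mJ) X).
pose mm : probability (T1 * T2)%type R := (m1 \x m2)%E.
apply: (product_measure_unique (m1 := mm) (m2 := mm)) => // A B mA mB.
have mA1 : measurable_fun setT (m2 \o xsection A) by exact: measurable_fun_xsection.
have mB1 : measurable_fun setT (m2 \o xsection B) by exact: measurable_fun_xsection.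
rewrite -[RHS](ge0_integral_prodM m1 m1 mA1 mB1)//.
apply: eq_integral => z _ /=.
(* With first coordinates fixed, the slice is a rectangle, made of one section of A and one of B, so
   its measure factors. *)
rewrite -product_measure1E; [|exact: measurable_xsection..].
congr (product_measure1 _ _ _); apply/seteqP; split => w.
  by rewrite /xsection/= !inE.
by rewrite /xsection/= !inE.
Qed.

Section measurable_row.
Context d1 (T : measurableType d1) {R : realType} {d : nat}.
Implicit Types f g : T -> 'rV[R]_d.

Lemma measurable_rowD f g : measurable_fun setT f -> measurable_fun setT g ->
  measurable_fun setT (fun t => f t + g t).
Proof.
move=> mf mg; apply: measurable_fun_coordP => i; 
rewrite (_ : (fun _ => _) =
    (fun t => Defs.coord i (f t) + Defs.coord i (g t))); last first.
  by apply/funext => t; rewrite /Defs.coord mxE.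
apply: measurable_funD.
  exact: (measurableT_comp (measurable_coord i) mf).
exact: (measurableT_comp (measurable_coord i) mg).
Qed.

Lemma measurable_rowZ (a : R) f : measurable_fun setT f ->
  measurable_fun setT (fun t => a *: f t).
Proof.
move=> mf; apply: measurable_fun_coordP => i; 
rewrite (_ : (fun _ => _) = (fun t => a * Defs.coord i (f t))); last first.
  by apply/funext => t; rewrite /Defs.coord mxE.
apply: measurable_funM => //.
exact: (measurableT_comp (measurable_coord i) mf).
Qed.

Lemma measurable_rowB f g : measurable_fun setT f -> measurable_fun setT g ->
  measurable_fun setT (fun t => f t - g t).
Proof.
move=> mf mg; under eq_fun do rewrite -scaleN1r.
by apply: measurable_rowD => //; exact: measurable_rowZ.
Qed.

Lemma measurable_row_entry f i : measurable_fun setT f ->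
  measurable_fun setT (fun t => f t ord0 i).
Proof. by move=> mf; exact: (measurableT_comp (measurable_coord i) mf). Qed.

End measurable_row.

Lemma preimage_measurable d1 d2 (T1 : measurableType d1)
    (T2 : measurableType d2) (f : T1 -> T2) (A : set T2) :
  measurable_fun setT f -> measurable A -> measurable (f @^-1` A).
Proof. by move=> mf mA; rewrite -[X in measurable X]setTI; exact: mf. Qed.

Section product_maps.
Local Open Scope ereal_scope.
Context d1 d2 d3 d4 (T1 : measurableType d1) (T2 : measurableType d2)
  (T3 : measurableType d3) (T4 : measurableType d4) (R : realType).
Variables (f : T1 -> T3) (g : T2 -> T4).
Hypotheses (mf : measurable_fun setT f) (mg : measurable_fun setT g).

Let mfg : measurable_fun setT (fun z : T1 * T2 => (f z.1, g z.2)).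
Proof.
apply: measurable_fun_pair.
  exact: (measurableT_comp mf measurable_fst).
exact: (measurableT_comp mg measurable_snd).
Qed.

Lemma product_measure_map (m1 : probability T1 R) (m2 : probability T2 R)
    (m3 : probability T3 R) (m4 : probability T4 R) :
  (forall A, measurable A -> m1 (f @^-1` A) = m3 A) ->
  (forall A, measurable A -> m2 (g @^-1` A) = m4 A) ->
  forall X, measurable X ->
  (m1 \x m2) ((fun z => (f z.1, g z.2)) @^-1` X) = (m3 \x m4) X.
Proof.
move=> m13 m24 X mX.
pose m12 : probability (T1 * T2)%type R := (m1 \x m2)%E.
rewrite -[LHS]/(distribution m12 (mfun_of mfg) X); apply/esym.
apply: product_measure_unique => // A B mA mB.
transitivity (m1 (f @^-1` A) * m2 (g @^-1` B)); last first.
  by congr (_ * _); [exact: m13|exact: m24].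
by rewrite -product_measure1E//; exact: preimage_measurable.
Qed.

End product_maps.

Lemma cons_rowl (R : realType) d (p : measurableTypeR R * 'rV[R]_d) (j : 'I_1) :
  cons_row p ord0 (@unsplit 1 d (inl j)) = p.1.
Proof. by rewrite /cons_row [LHS]row_mxEl mxE. Qed.

Lemma cons_rowr (R : realType) d (p : measurableTypeR R * 'rV[R]_d) (j : 'I_d) :
  cons_row p ord0 (@unsplit 1 d (inr j)) = p.2 ord0 j.
Proof. by rewrite /cons_row [LHS]row_mxEr. Qed.

Section gauss_reflection.
Context {R : realType}.
Variables c s : R.
Hypotheses (s0 : 0 < s) (cs : c ^+ 2 + s ^+ 2 = 1).

Definition reflection d (z : 'rV[R]_d * 'rV[R]_d) : 'rV[R]_d * 'rV[R]_d :=
  (c *: z.1 + s *: z.2, s *: z.1 - c *: z.2).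

Lemma measurable_reflection d : measurable_fun setT (@reflection d).
Proof.
by apply: measurable_fun_pair; [apply: measurable_rowD|apply: measurable_rowB];
  apply: measurable_rowZ.
Qed.

Lemma cons_row_reflection d (p : R * R) (q : 'rV[R]_d * 'rV[R]_d) :
  reflection (cons_row (p.1, q.1), cons_row (p.2, q.2)) =
  (cons_row (c * p.1 + s * p.2, (reflection q).1),
   cons_row (s * p.1 - c * p.2, (reflection q).2)).
Proof.
have E a b (u v : measurableTypeR R * 'rV[R]_d) :
    a *: cons_row u + b *: cons_row v =
    cons_row (a * u.1 + b * v.1, a *: u.2 + b *: v.2).
  apply/rowP => i; rewrite [LHS]mxE [X in X + _]mxE [X in _ + X]mxE.
  rewrite -[i](@splitK 1 d); case: (@fintype.split 1 d i) => j.
    by rewrite !cons_rowl.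
  by rewrite !cons_rowr/= !mxE.
by rewrite /reflection /= -scaleNr !E /= mulNr scaleNr.
Qed.

(** Induction on the dimension: after regrouping, the reflection is the product of the planar one on
    the heads and the one in dimension [d] on the tails. *)
Lemma std_gauss2_reflection d X : measurable X ->
  ((std_gauss R d \x std_gauss R d) (@reflection d @^-1` X) =
   (std_gauss R d \x std_gauss R d) X)%E.
Proof.
elim: d X => [|d IH] X mX.
  congr (product_measure1 _ _ _); apply/seteqP.
  have E z : reflection z = z :> 'rV[R]_0 * 'rV[R]_0.
    case: z => u v; rewrite /reflection.
    by congr pair; rewrite [LHS]thinmx0 [RHS]thinmx0.
  by split => z; rewrite /= E.
pose ng : probability (measurableTypeR R * 'rV[R]_d)%type R :=
  (normal_prob 0 1 \x std_gauss R d)%E.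
pose RR := measurableTypeR R.
pose J (z : (RR * RR) * ('rV[R]_d * 'rV[R]_d)) :=
  ((z.1.1, z.2.1), (z.1.2, z.2.2)).
pose cc (z : (RR * 'rV[R]_d) * (RR * 'rV[R]_d)) := (cons_row z.1, cons_row z.2).
have mcons := @measurable_cons_row R d.
have mcc : measurable_fun setT cc.
  apply: measurable_fun_pair.
    exact: (measurableT_comp mcons measurable_fst).
  exact: (measurableT_comp mcons measurable_snd).
(* [J] undoes the regrouping and [cc] reassembles the two vectors from their heads and tails. *)
have step Y : measurable Y ->
    ((std_gauss R d.+1 \x std_gauss R d.+1) Y =
    ((normal_prob 0 1 \x normal_prob 0 1) \x (std_gauss R d \x std_gauss R d))
      (J @^-1` (cc @^-1` Y)))%E.
  move=> mY.
  rewrite -(product_measure_swap (normal_prob 0 1) (std_gauss R d))//; last first.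
    exact: preimage_measurable.
  apply/esym.
  exact: (product_measure_map mcons mcons (m1 := ng) (m2 := ng)).
have mrX := preimage_measurable (@measurable_reflection d.+1) mX.
apply: (etrans (step _ mrX)); apply/esym; apply: (etrans (step _ mX)).
pose nn : probability (measurableTypeR R * measurableTypeR R)%type R :=
  (normal_prob 0 1 \x normal_prob 0 1)%E.
pose gg : probability ('rV[R]_d * 'rV[R]_d)%type R :=
  (std_gauss R d \x std_gauss R d)%E.
pose r1 (z : RR * RR) : RR * RR := (c * z.1 + s * z.2, s * z.1 - c * z.2).
have mr1 : measurable_fun setT r1.
  apply: measurable_fun_pair.
    by apply: measurable_funD; apply: measurable_funM.
  by apply: measurable_funB; apply: measurable_funM.
have mJX : measurable (J @^-1` (cc @^-1` X)).
  apply: preimage_measurable; last exact: preimage_measurable.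
  apply: measurable_fun_pair; apply: measurable_fun_pair;
  by do ?apply: measurableT_comp.
have H1 A : measurable A -> nn (r1 @^-1` A) = nn A.
  by move=> mA; exact: normal_prob2_reflection.
have H2 A : measurable A -> gg (@reflection d @^-1` A) = gg A.
  by move=> mA; exact: IH.
have H := product_measure_map mr1 (@measurable_reflection d) H1 H2 mJX.
have E : (fun z => (r1 z.1, reflection z.2)) @^-1` (J @^-1` (cc @^-1` X)) =
    J @^-1` (cc @^-1` (@reflection d.+1 @^-1` X)).
  have Ez z : cc (J (r1 z.1, reflection z.2)) = reflection (cc (J z)).
    by rewrite /cc /J cons_row_reflection.
  by apply/seteqP; split => z /=; rewrite Ez.
by rewrite E in H; exact: esym.
Qed.

(** The iterated form is the one that the chain produces, with one Gaussian integral per step. *)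
Lemma ge0_integral_gauss_reflection d (f : 'rV[R]_d * 'rV[R]_d -> \bar R) :
  measurable_fun setT f -> (forall z, 0 <= f z)%E ->
  (\int[std_gauss R d]_x \int[std_gauss R d]_y
      f ((c *: x + s *: y)%R, (s *: x - c *: y)%R) =
   \int[std_gauss R d]_x \int[std_gauss R d]_y f (x, y))%E.
Proof.
move=> mf f0; set g := std_gauss R d.
pose gg : probability ('rV[R]_d * 'rV[R]_d)%type R := (g \x g)%E.
have mr := @measurable_reflection d.
have /= <- := fubini_tonelli1 (m1 := g) (m2 := g) (f \o @reflection d)
  (measurableT_comp mf mr) (fun=> f0 _).
have /= <- // := fubini_tonelli1 (m1 := g) (m2 := g) f.
apply: etrans (esym (ge0_integral_distribution (P := gg) (mfun_of mr) mf f0)) _.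
by apply: eq_measure_integral => A mA _; exact: std_gauss2_reflection.
Qed.

End gauss_reflection.

(** * First and second moments *)

Section normal_moments.
Context {R : realType}.
Local Notation mu := (@lebesgue_measure R).
Local Notation phi := (normal_pdf (0 : R) 1).

Lemma normal_pdf01E x :
  phi x = normal_peak 1 * expR (- (2^-1 * x ^+ 2)).
Proof.
rewrite normal_pdfE ?oner_eq0// /normal_fun subr0 expr1n.
by congr (_ * expR _); rewrite mulNr mulrC.
Qed.

Lemma normal_pdf01N x : phi (- x) = phi x.
Proof. by rewrite !normal_pdf01E sqrrN. Qed.

Lemma is_derive_normal_pdf01 (x : R) :
  is_derive x 1 (fun t => - phi t) (x * phi x).
Proof.
under eq_fun do rewrite normal_pdf01E -mulrN.
apply: is_derive_eq.
by rewrite normal_pdf01E /GRing.scale/=; field.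
Qed.

Lemma cvg_normal_pdf01 : phi x @[x --> +oo%R] --> (0 : R).
Proof.
under eq_fun do rewrite normal_pdf01E.
rewrite -[X in nbhs X](mulr0 (normal_peak (1 : R))); apply: cvgM.
  exact: cvg_cst.
apply: (cvg_comp (fun x => 2^-1 * x ^+ 2) (fun x => expR (- x))).
  apply: gt0_cvgMry; first by rewrite invr_gt0.
  exact: cvgr_expr2.
exact: cvgr_expR.
Qed.

(** Since phi' = - t phi, an antiderivative of the integrand is - phi, which vanishes at
    infinity. *)
Lemma integral_normal_tail (x : R) : 0 <= x ->
  (\int[mu]_(t in `[x, +oo[) (t * phi t)%:E = (phi x)%:E)%E.
Proof.
move=> x0.
have cphi : continuous phi by apply: continuous_normal_pdf; rewrite oner_eq0.
have dphi t : derivable (fun t => - phi t) t 1.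
  by have [] := is_derive_normal_pdf01 t.
rewrite (@ge0_continuous_FTC2y _ _ (fun t => - phi t) _ 0)//.
- by rewrite -EFinB sub0r opprK.
- by move=> t xt; rewrite mulr_ge0 ?normal_pdf_ge0// (le_trans x0).
- by apply: continuous_subspaceT => t; apply: cvgM; [exact: cvg_id|exact: cphi].
- by have := cvgN cvg_normal_pdf01; rewrite oppr0; exact.
- by apply: cvg_at_right_filter; apply: cvgN; exact: cphi.
- move=> t _; rewrite derive1E.
  by have [] := is_derive_normal_pdf01 t.
Qed.

(* Tonelli for the function t p t on {(x, t) | 0 <= x <= t}. For p the Gaussian
   density this replaces an integration by parts. *)
Lemma integral_sqr_tail (p : R -> R) :
  measurable_fun setT p -> (forall x, 0 <= p x) ->
  (forall x, 0 <= x -> (\int[mu]_(t in `[x, +oo[) (t * p t)%:E = (p x)%:E)%E) ->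
  (\int[mu]_(t in `[0%R, +oo[) (t ^+ 2 * p t)%:E =
   \int[mu]_(t in `[0%R, +oo[) (p t)%:E)%E.
Proof.
move=> mp p0 tail.
have itvE (y : R) : (y \in `[0%R, +oo[%classic) = (0 <= y).
  by apply/idP/idP => [/set_mem|y0]; [|apply/mem_set]; rewrite /= in_itv/= andbT.
pose A := [set z : R * R | 0 <= z.1 <= z.2].
have mA : measurable A.
  rewrite (_ : A = (fun z : R * R => z.1) @^-1` `[0, +oo[ `&`
      (fun z : R * R => z.2 - z.1) @^-1` `[0, +oo[); last first.
    apply/seteqP; split => z; rewrite /A/= !in_itv/= !andbT subr_ge0.
      by move=> /andP[].
    by move=> [-> ->].
  apply: measurableI; apply: preimage_measurable => //.
    exact: measurable_fst.
  by apply: measurable_funB.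
pose K (z : R * R) : \bar R := (\1_A z * (z.2 * p z.2))%:E.
have K0 z : (0 <= K z)%E.
  rewrite lee_fin indicE; have [|_] := boolP (z \in A); last by rewrite mul0r.
  rewrite inE => /andP[z1 z2]; rewrite mul1r mulr_ge0 ?p0//.
  exact: le_trans z2.
have mK : measurable_fun setT K.
  apply/measurable_EFinP; apply: measurable_funM => //.
  apply: measurable_funM => //.
  exact: (measurableT_comp mp measurable_snd).
have /= H := fubini_tonelli (m1 := mu) (m2 := mu) K mK K0.
(* Integrating in x first yields the length y of [0, y] times y p(y). Integrating in y first yields
   p(x), by [tail]. *)
transitivity (\int[mu]_y \int[mu]_x K (x, y))%E.
  rewrite integral_mkcond; apply: eq_integral => y _; rewrite patchE.
  transitivity (\int[mu]_x ((y * p y)%:E * (\1_(`[0%R, y]%classic) x)%:E))%E.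
    rewrite itvE; case: ifPn => y0.
      rewrite ge0_integralZl; first last.
      - by rewrite lee_fin mulr_ge0 ?p0.
      - by move=> x _; rewrite lee_fin.
      - exact/measurable_EFinP/measurable_indic.
      - exact: measurableT.
      have -> : (\int[mu]_x (\1_(`[0%R, y]%classic) x)%:E = y%:E)%E.
        rewrite integral_indic; [|exact: measurableT|exact: measurable_itv].
        rewrite setIT /= lebesgue_measure_itv /= lte_fin.
        move: y0; rewrite le_eqVlt => /predU1P[<-|->]; first by rewrite ltxx.
        by rewrite oppr0 adde0.
      by rewrite -EFinM; congr EFin; ring.
    apply/esym/integral0_eq => x _; rewrite indicE memNset ?mule0//=.
    by rewrite in_itv/= => /andP[/le_trans h /h]; exact/negP.
  apply: eq_integral => x _; rewrite /K [in RHS]mulrC [RHS]EFinM !indicE.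
  have -> // : (x \in `[0%R, y]%classic) = ((x, y) \in A).
  by apply/idP/idP => /set_mem h; apply/mem_set; move: h; rewrite /A/= in_itv.
rewrite -H [RHS]integral_mkcond; apply: eq_integral => x _; rewrite patchE.
rewrite itvE; case: ifPn => x0.
  rewrite -tail// [RHS]integral_mkcond.
  apply: eq_integral => y _; rewrite /K patchE indicE.
  have -> : ((x, y) \in A) = (y \in `[x, +oo[%classic).
    by apply/idP/idP => /set_mem h; apply/mem_set; move: h;
      rewrite /A/= in_itv/= x0 andbT.
  by case: ifPn; rewrite ?mul1r// mul0r.
apply: integral0_eq => y _; rewrite /K indicE memNset ?mul0r//.
by rewrite /A/=; move/negP: x0 => x0 /andP[].
Qed.

(** By evenness the half line is enough; there [integral_sqr_tail] removes the factor x^2, and the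
    total mass of the density remains. *)
Lemma integral_normal_sqr :
  (\int[normal_prob 0 1]_x (x ^+ 2)%:E = 1 :> \bar R)%E.
Proof.
have cphi : continuous phi by apply: continuous_normal_pdf; rewrite oner_eq0.
rewrite integral_normal_prob01//; last 2 first.
- by apply/measurable_EFinP; exact: measurable_funX.
- by move=> x; rewrite lee_fin sqr_ge0.
under eq_integral do rewrite -EFinM.
rewrite (ge0_symfun_integralT (f := fun x => x ^+ 2 * phi x)); first last.
- by move=> x /=; rewrite normal_pdf01N sqrrN.
- by move=> x; apply: cvgM; [exact: exprn_continuous|exact: cphi].
- by move=> x; rewrite mulr_ge0 ?sqr_ge0 ?normal_pdf_ge0.
rewrite -set_itvcy integral_sqr_tail; first last.
- exact: integral_normal_tail.
- by move=> x; exact: normal_pdf_ge0.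
- exact: measurable_normal_pdf.
rewrite set_itvcy.
rewrite -ge0_symfun_integralT//; first exact: integral_normal_pdf.
- by move=> x; exact: normal_pdf_ge0.
- by move=> x /=; rewrite normal_pdf01N.
Qed.

Lemma normal_prob01N (A : set (measurableTypeR R)) : measurable A ->
  normal_prob 0 1 (-%R @^-1` A) = normal_prob 0 1 A.
Proof.
move=> mA; rewrite /normal_prob [RHS](@ge0_integral_affine _ (-1) 0)//.
- rewrite normrN1 mul1e.
  rewrite (_ : (fun x : R => -1 * x + 0) = -%R); last first.
    by apply/funext => x; rewrite mulN1r addr0.
  by apply: eq_integral => x _; rewrite mulN1r addr0 normal_pdf01N.
- by apply/measurable_funTS/measurable_EFinP; exact: measurable_normal_pdf.
- by move=> x _; rewrite lee_fin normal_pdf_ge0.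
Qed.

End normal_moments.

(** * Square-integrable functions and integrals under equal laws *)

Section square_integrable.
Context d (T : measurableType d) (R : realType).
Variables (mu : {measure set T -> \bar R}) (D : set T).
Hypothesis mD : measurable D.
Implicit Types f g : T -> R.

Lemma integrable_mul_sqr f g : measurable_fun D f -> measurable_fun D g ->
  mu.-integrable D (fun x => (f x ^+ 2)%:E) ->
  mu.-integrable D (fun x => (g x ^+ 2)%:E) ->
  mu.-integrable D (fun x => (f x * g x)%:E).
Proof.
move=> mf mg if2 ig2.
apply: (le_integrable mD _ _ (integrableD mD if2 ig2)).
  by apply/measurable_EFinP; exact: measurable_funM.
move=> x _ /=; rewrite lee_fin [leRHS]ger0_norm ?addr_ge0 ?sqr_ge0//.
by rewrite ler_norml; apply/andP; split; nra.
Qed.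

Lemma integrable_sqrD f g : measurable_fun D f -> measurable_fun D g ->
  mu.-integrable D (fun x => (f x ^+ 2)%:E) ->
  mu.-integrable D (fun x => (g x ^+ 2)%:E) ->
  mu.-integrable D (fun x => ((f x + g x) ^+ 2)%:E).
Proof.
move=> mf mg if2 ig2.
apply: (le_integrable mD _ _ (integrableZl mD 2 (integrableD mD if2 ig2))).
  by apply/measurable_EFinP/measurable_funX; exact: measurable_funD.
move=> x _ /=; rewrite lee_fin ger0_norm ?sqr_ge0//.
have := sqr_ge0 (f x - g x); have := sqr_ge0 (f x); have := sqr_ge0 (g x).
by move=> ? ? ?; rewrite ger0_norm; nra.
Qed.

Lemma integrable_sqrZ (k : R) f :
  mu.-integrable D (fun x => (f x ^+ 2)%:E) ->
  mu.-integrable D (fun x => ((k * f x) ^+ 2)%:E).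
Proof.
move=> if2; have := integrableZl mD (k ^+ 2) if2.
by apply: eq_integrable => // x _; rewrite -EFinM exprMn.
Qed.

End square_integrable.

(** Write f as f times 1; the constant 1 is square-integrable for a probability. *)
Lemma integrable_sqr d (T : measurableType d) (R : realType)
    (P : probability T R) (f : T -> R) : measurable_fun setT f ->
  P.-integrable setT (fun x => (f x ^+ 2)%:E) ->
  P.-integrable setT (EFin \o f).
Proof.
move=> mf if2.
have i1 : P.-integrable setT (fun=> (1 ^+ 2)%:E).
  exact: (finite_measure_integrable_cst P (1 ^+ 2)).
have := integrable_mul_sqr measurableT mf (g := fun=> 1) _ if2 i1.
move=> /(_ (@measurable_cst _ _ _ _ _ _)).
by apply: eq_integrable => // x _; rewrite mulr1.
Qed.

Lemma integral_prob_cst d (T : measurableType d) (R : realType)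
    (P : probability T R) (k : R) : (\int[P]_w k%:E = k%:E)%E.
Proof. by rewrite integral_cst//= probability_setT mule1. Qed.

Section same_law.
Local Open Scope ereal_scope.
Context d1 d2 d3 (T1 : measurableType d1) (T2 : measurableType d2)
  (T3 : measurableType d3) (R : realType).
Variables (P : probability T1 R) (Q : probability T2 R).
Variables (X : T1 -> T3) (Y : T2 -> T3).
Hypotheses (mX : measurable_fun setT X) (mY : measurable_fun setT Y).
Hypothesis XY : forall B, measurable B -> P (X @^-1` B) = Q (Y @^-1` B).

Lemma ge0_integral_same_law (f : T3 -> \bar R) : measurable_fun setT f ->
  (forall x, 0 <= f x) -> \int[P]_w f (X w) = \int[Q]_w f (Y w).
Proof.
move=> mf f0.
apply: etrans (esym (ge0_integral_distribution (P := P) (mfun_of mX) mf f0)) _.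
apply: etrans (ge0_integral_distribution (P := Q) (mfun_of mY) mf f0).
by apply: eq_measure_integral => A mA _; exact: XY.
Qed.

Lemma integral_same_law (f : T3 -> R) : measurable_fun setT f ->
  Q.-integrable setT (fun w => (f (Y w))%:E) ->
  P.-integrable setT (fun w => (f (X w))%:E) /\
  \int[P]_w (f (X w))%:E = \int[Q]_w (f (Y w))%:E.
Proof.
move=> mf iY; have mf' : measurable_fun setT (EFin \o f) by exact/measurable_EFinP.
have iX : P.-integrable setT (fun w => (f (X w))%:E).
  apply/integrableP; split; first exact: (measurableT_comp mf' mX).
  rewrite (ge0_integral_same_law (f := fun y => `|(f y)%:E|))//.
    by case/integrableP: iY.
  exact: measurableT_comp.
split => //.
apply: etrans (esym (integral_distribution (P := P) (X := mfun_of mX) mf' iX)) _.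
apply: etrans (integral_distribution (P := Q) (X := mfun_of mY) mf' iY).
by apply: eq_measure_integral => A mA _; exact: XY.
Qed.

End same_law.

(** The law is invariant under negation, so the mean equals its opposite. Its finiteness, needed to
    conclude, comes from the second moment. *)
Lemma integral_normal_id (R : realType) :
  (normal_prob (0 : R) 1).-integrable setT (fun x : R => x%:E) /\
  (\int[normal_prob (0 : R) 1]_x x%:E = 0 :> \bar R)%E.
Proof.
have mN : measurable_fun [set: measurableTypeR R] (-%R : R -> R) by [].
have i2 : (normal_prob (0 : R) 1).-integrable setT (fun x : R => (x ^+ 2)%:E).
  apply/integrableP; split.
    by apply/measurable_EFinP; exact: measurable_funX.
  under eq_integral do rewrite gee0_abs ?lee_fin ?sqr_ge0//.
  by rewrite integral_normal_sqr ltry.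
have i1 : (normal_prob (0 : R) 1).-integrable setT (fun x : R => x%:E).
  by apply: (@integrable_sqr _ _ _ (normal_prob (0 : R) 1) (fun x : R => x)).
split => //.
have [_] := @integral_same_law _ _ _ (measurableTypeR R) (measurableTypeR R)
  (measurableTypeR R) R (normal_prob 0 1) (normal_prob 0 1) -%R id mN
  (@measurable_id _ _ _) (@normal_prob01N R) id (@measurable_id _ _ _) i1.
have E : (\int[normal_prob (0 : R) 1]_x (- x)%:E =
    - \int[normal_prob (0 : R) 1]_x x%:E)%E.
  by rewrite -integralN//; exact: integrable_add_def.
rewrite E.
have /fineK <- := integrable_fin_num measurableT i1.
by move=> -[] h; congr EFin; lra.
Qed.

(** * Random vectors with scalar covariance *)

Section isotropic.
Local Open Scope ereal_scope.
Context {R : realType} {d : nat}.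

(** Mean m and covariance v times the identity, through raw moments. Finite second moments are part
    of it, since the [fine] in [mean_vec] and [cov_mx] would read an infinite value as 0. The term
    [v *+ (i == j)] is v times the Kronecker delta. *)
Definition isotropic d1 (T : measurableType d1) (P : probability T R)
    (Y : T -> 'rV[R]_d) (m : 'rV[R]_d) (v : R) : Prop :=
  [/\ measurable_fun setT Y,
      forall i, P.-integrable setT (fun w => (Y w ord0 i ^+ 2)%:E),
      forall i, \int[P]_w (Y w ord0 i)%:E = (m ord0 i)%:E &
      forall i j, \int[P]_w (Y w ord0 i * Y w ord0 j)%:E =
        (m ord0 i * m ord0 j + v *+ (i == j))%:E ].

Section isotropic_lemmas.
Context d1 (T : measurableType d1) (P : probability T R).
Implicit Types (Y : T -> 'rV[R]_d) (m : 'rV[R]_d) (v : R).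

Lemma isotropic_integrable Y m v i : isotropic P Y m v ->
  P.-integrable setT (fun w => (Y w ord0 i)%:E).
Proof.
move=> [mY i2 _ _].
apply: (@integrable_sqr _ _ _ P (fun w => Y w ord0 i)) => //.
exact: measurable_row_entry.
Qed.

Lemma isotropic_integrableM Y m v i j : isotropic P Y m v ->
  P.-integrable setT (fun w => (Y w ord0 i * Y w ord0 j)%:E).
Proof.
move=> [mY i2 _ _]; apply: integrable_mul_sqr => //; exact: measurable_row_entry.
Qed.

Lemma isotropic_mean_vec Y m v : isotropic P Y m v -> mean_vec P Y = m.
Proof.
by move=> [_ _ Em _]; apply/rowP => i; rewrite mxE unlock Em.
Qed.

Lemma isotropic_cov_mx Y m v : isotropic P Y m v -> cov_mx P Y = v%:M.
Proof.
move=> iY; have [mY i2 Em EE] := iY; apply/matrixP => i j; rewrite !mxE.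
have l1 k : (fun w => Y w ord0 k) \in Lfun P 1.
  exact/Lfun1_integrable/(isotropic_integrable k iY).
rewrite covarianceE//; last exact/Lfun1_integrable/(isotropic_integrableM i j iY).
by rewrite unlock !Em [X in fine (X - _)]EE -EFinM -EFinB /= addrC addKr.
Qed.

Lemma isotropic_affine Y m v (a : 'rV[R]_d) (s : R) : isotropic P Y m v ->
  isotropic P (fun w => a + s *: Y w)%R (a + s *: m)%R (s ^+ 2 * v).
Proof.
move=> iY; have [mY i2 Em EE] := iY.
have E w i : ((a + s *: Y w) ord0 i = a ord0 i + s * Y w ord0 i)%R by rewrite !mxE.
have icst (k : R) : P.-integrable setT (EFin \o cst k).
  exact: finite_measure_integrable_cst.
have i1 k := isotropic_integrable k iY.
have iM i j := isotropic_integrableM i j iY.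
split.
- by apply: measurable_rowD => //; exact: measurable_rowZ.
- move=> i; under eq_fun do rewrite E.
  apply: integrable_sqrD => //.
  + by apply: measurable_funM => //; exact: measurable_row_entry.
  + exact: (icst (a ord0 i ^+ 2)%R).
  + exact: integrable_sqrZ.
- move=> i; under eq_integral do rewrite E EFinD EFinM.
  rewrite integralD//=; [|exact: (icst (a ord0 i))|exact: integrableZl].
  rewrite integral_prob_cst integralZl// Em.
  by rewrite -EFinM -EFinD !mxE.
- move=> i j.
  transitivity (\int[P]_w ((a ord0 i * a ord0 j)%:E +
     ((a ord0 i * s)%:E * (Y w ord0 j)%:E + ((a ord0 j * s)%:E * (Y w ord0 i)%:E
      + (s ^+ 2)%:E * (Y w ord0 i * Y w ord0 j)%:E)))).
    apply: eq_integral => w _; rewrite !E -!EFinM -!EFinD; congr EFin; ring.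
  rewrite integralD//=; [|exact: (icst (a ord0 i * a ord0 j)%R)|]; last first.
    apply: integrableD => //; first exact: integrableZl.
    by apply: integrableD => //; exact: integrableZl.
  rewrite integralD//=; [|exact: integrableZl|]; last first.
    by apply: integrableD => //; exact: integrableZl.
  rewrite integralD//=; [|exact: integrableZl..].
  rewrite integral_prob_cst !integralZl// !Em EE.
  rewrite -!EFinM -!EFinD !mxE; congr EFin.
  by case: (i == j); rewrite ?mulr1n ?mulr0n; ring.
Qed.

End isotropic_lemmas.

Lemma isotropic_same_law d1 d2 (T1 : measurableType d1) (T2 : measurableType d2)
    (P : probability T1 R) (Q : probability T2 R)
    (X : T1 -> 'rV[R]_d) (Y : T2 -> 'rV[R]_d) m v :
  measurable_fun setT X ->
  (forall B, measurable B -> P (X @^-1` B) = Q (Y @^-1` B)) ->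
  isotropic Q Y m v -> isotropic P X m v.
Proof.
move=> mX XY iY; have [mY i2 Em EE] := iY.
have me i : measurable_fun setT (fun x : 'rV[R]_d => x ord0 i).
  exact: measurable_coord.
split => //.
- move=> i.
  apply: (integral_same_law mX mY XY (f := fun x => x ord0 i ^+ 2)%R _ (i2 i)).1.
  exact: measurable_funX.
- move=> i; rewrite -Em.
  exact: (integral_same_law mX mY XY (f := fun x => x ord0 i) (me i)
    (isotropic_integrable i iY)).2.
- move=> i j; rewrite -EE.
  apply: (integral_same_law mX mY XY (f := fun x => x ord0 i * x ord0 j)%R _
    (isotropic_integrableM i j iY)).2.
  exact: measurable_funM.
Qed.

End isotropic.

Lemma isotropic_std_gauss (R : realType) d : isotropic (std_gauss R d) id 0 1.
Proof.
elim: d => [|d IH].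
  by split => [//| | |]; case.
pose ng : probability (measurableTypeR R * 'rV[R]_d)%type R :=
  (normal_prob 0 1 \x std_gauss R d)%E.
have mcons := @measurable_cons_row R d.
suff : isotropic ng (@cons_row R d) 0 1.
  exact: isotropic_same_law.
have [_ i2 Em EE] := IH.
(* A moment that involves only the head, or only the tail, is a product moment whose other factor is
   the constant 1. *)
have n1 : (normal_prob (0 : R) 1).-integrable setT (EFin \o (fun=> 1)).
  exact: (finite_measure_integrable_cst (normal_prob (0 : R) 1) 1).
have g1 : (std_gauss R d).-integrable setT (EFin \o (fun=> 1)).
  exact: (finite_measure_integrable_cst (std_gauss R d) 1).
have [nx Ex] := integral_normal_id R.
have nx2 : (normal_prob (0 : R) 1).-integrable setT
    (EFin \o (fun x : R => x ^+ 2)).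
  apply/integrableP; split.
    by apply/measurable_EFinP; exact: measurable_funX.
  under eq_integral do rewrite gee0_abs ?lee_fin ?sqr_ge0//.
  by rewrite integral_normal_sqr ltry.
have gx k := isotropic_integrable k IH.
have n11 : (\int[normal_prob (0 : R) 1]_x 1%:E = 1 :> \bar R)%E.
  exact: integral_prob_cst.
have g11 : (\int[std_gauss R d]_x 1%:E = 1 :> \bar R)%E.
  exact: integral_prob_cst.
split => //.
- move=> i; rewrite -[i](@splitK 1 d); case: (@fintype.split 1 d i) => j.
    have [+ _] := integral_prodM nx2 g1.
    by apply: eq_integrable => // z _; rewrite cons_rowl mulr1.
  have [+ _] := integral_prodM n1 (i2 j).
  by apply: eq_integrable => // z _; rewrite cons_rowr mul1r.
- move=> i; rewrite [X in _ = X%:E]mxE -[i](@splitK 1 d).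
  case: (@fintype.split 1 d i) => j.
    have [_] := integral_prodM nx g1; rewrite Ex mul0e => H; apply: etrans _ H.
    by apply: eq_integral => z _; rewrite cons_rowl mulr1.
  have [_] := integral_prodM n1 (gx j); rewrite Em mxE mule0 => H; apply: etrans _ H.
  by apply: eq_integral => z _; rewrite cons_rowr mul1r.
- move=> i j; rewrite [X in X * _ + _]mxE mul0r add0r.
  rewrite -[i](@splitK 1 d) -[j](@splitK 1 d) (can_eq (@unsplitK 1 d)).
  case: (@fintype.split 1 d i) => i'; case: (@fintype.split 1 d j) => j'.
  + rewrite !ord1 eqxx mulr1n.
    have [_] := integral_prodM nx2 g1; rewrite integral_normal_sqr g11 mule1 => H.
    apply: etrans _ H.
    by apply: eq_integral => z _; rewrite !cons_rowl mulr1.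
  + have [_] := integral_prodM nx (gx j'); rewrite Ex mul0e => H; apply: etrans _ H.
    by apply: eq_integral => z _; rewrite cons_rowl cons_rowr.
  + have [_] := integral_prodM nx (gx i'); rewrite Ex mul0e => H; apply: etrans _ H.
    by apply: eq_integral => z _; rewrite cons_rowl cons_rowr mulrC.
  + have [_] := integral_prodM n1 (isotropic_integrableM i' j' IH).
    rewrite n11 mul1e EE !mxE mul0r add0r => H; apply: etrans _ H.
    by apply: eq_integral => z _; rewrite !cons_rowr mul1r.
Qed.

Lemma isotropic_gauss (R : realType) d (m : 'rV[R]_d) (v : R) : 0 <= v ->
  isotropic (gauss m v) id m v.
Proof.
move=> v0; suff : isotropic (std_gauss R d) (shift_scale m (Num.sqrt v)) m v.
  exact: isotropic_same_law.
have := isotropic_affine m (Num.sqrt v) (isotropic_std_gauss R d).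
by rewrite scaler0 addr0 mulr1 sqr_sqrtr.
Qed.

(** * The forward chain and its posterior *)

Section schedule_facts.
Variables (R : realType) (S : schedule R).

Lemma acoef_itv k : (0 < k <= nsteps S)%N -> 0 < acoef S k < 1.
Proof.
by move=> /(bcoef_itv (s := S)) /andP[b0 b1]; rewrite /acoef; apply/andP; split; lra.
Qed.

Lemma abar0 : abar S 0 = 1.
Proof. by rewrite /abar big_geq. Qed.

Lemma abarS k : abar S k.+1 = abar S k * acoef S k.+1.
Proof. by rewrite /abar big_nat_recr. Qed.

(** The upper bound is attained at k = 0; for positive k it is strict, by [abar_lt1]. *)
Lemma abar_itv k : (k <= nsteps S)%N -> 0 < abar S k <= 1.
Proof.
elim: k => [_|k IH kN]; first by rewrite abar0 ltr01 lexx.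
have /andP[p0 p1] := IH (ltnW kN).
have /andP[a0 a1] : 0 < acoef S k.+1 < 1 by apply: acoef_itv.
by rewrite abarS; apply/andP; split; nra.
Qed.

Lemma abar_lt1 k : (0 < k <= nsteps S)%N -> abar S k < 1.
Proof.
case: k => // k kN; have /andP[p0 p1] := abar_itv (ltnW kN).
have /andP[a0 a1] := acoef_itv kN.
by rewrite abarS; nra.
Qed.

(** The value 0 occurs at k = 1, where the reverse kernel is a Dirac mass. *)
Lemma btilde_ge0 k : (0 < k <= nsteps S)%N -> 0 <= btilde S k.
Proof.
case: k => // k kN; have /andP[p0 p1] := abar_itv (ltnW kN).
have q1 := abar_lt1 kN; have /andP[b0 b1] := bcoef_itv kN.
by rewrite /btilde mulr_ge0 ?divr_ge0 ?subr_ge0// ltW.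
Qed.

Lemma noise_of_predicted_clean d (eps : 'rV[R]_d -> R -> 'rV[R]_d) k x :
  (0 < k <= nsteps S)%N ->
  noise_of S k x (predicted_clean S eps k x) = eps x (tgrid S k).
Proof.
move=> kN; rewrite /noise_of /predicted_clean.
have /andP[p0 _] : 0 < abar S k <= 1 by apply: abar_itv; case/andP: kN.
rewrite scalerA divff ?gt_eqF ?sqrtr_gt0// scale1r opprB addrCA subrr addr0.
by rewrite scalerA mulVf ?scale1r// gt_eqF ?sqrtr_gt0 ?subr_gt0 ?abar_lt1.
Qed.

Lemma ddpm_kernelE d (eps : 'rV[R]_d -> R -> 'rV[R]_d) k x :
  (0 < k <= nsteps S)%N ->
  ddpm_kernel S eps k x = posterior S k x (predicted_clean S eps k x).
Proof.
by move=> kN; rewrite /ddpm_kernel /posterior /ddpm_mean noise_of_predicted_clean.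
Qed.

End schedule_facts.

(** * Generated sigma-algebras and disintegration of Gaussian kernels *)

Section sigma_gen_facts.
Context {R : realType} {d : nat} {dO : measure_display}
  {Omega : measurableType dO} {I : Type}.
Variables (X : I -> Omega -> 'rV[R]_d) (J : set I).

(** Omega with the generated sigma-algebra as its measurable structure: membership in
    [sigma_gen X J] becomes [measurable], and the lemmas on measurable maps apply. *)
Definition sigma_gen_type := g_sigma_algebraType
  (\bigcup_(j in J) preimage_set_system setT (X j) measurable).

Lemma measurable_sigma_gen_type j : J j ->
  measurable_fun [set: sigma_gen_type] (X j : sigma_gen_type -> 'rV[R]_d).
Proof.
by move=> Jj _ B mB; apply: sub_sigma_algebra; exists j => //; exists B.
Qed.

Lemma sigma_gen_preimage d2 (T : measurableType d2)
    (f : sigma_gen_type -> T) B :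
  measurable_fun setT f -> measurable B -> sigma_gen X J (f @^-1` B).
Proof. by move=> mf mB; have := preimage_measurable mf mB. Qed.

(** Preimages under f of measurable sets form a sigma-algebra; it contains the generators because
    every X_j is a function of f. *)
Lemma sigma_gen_sub_preimage d2 (T : measurableType d2) (f : Omega -> T) :
  (forall j, J j -> exists2 g : T -> 'rV[R]_d, measurable_fun setT g &
     X j = g \o f) ->
  forall E, sigma_gen X J E -> exists2 D, measurable D & E = f @^-1` D.
Proof.
move=> Xf E GE.
suff : preimage_set_system setT f measurable E.
  by move=> [D mD <-]; exists D => //; rewrite setTI.
apply: (smallest_sub _ _ GE).
  apply: sigma_algebra_preimage; split.
  - exact: measurable0.
  - by move=> A mA; rewrite setTD; exact: measurableC.
  - by move=> F mF; exact: bigcupT_measurable.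
move=> _ [j Jj [B mB <-]]; have [g mg ->] := Xf _ Jj.
by exists (g @^-1` B); [exact: preimage_measurable|].
Qed.

End sigma_gen_facts.

Section disintegration.
Local Open Scope ereal_scope.
Context {R : realType} {d : nat} {dO d2 : measure_display}
  {Omega : measurableType dO} {T : measurableType d2}.
Variable P : probability Omega R.

Lemma measurable_gauss_step (m : T -> 'rV[R]_d) (s : R) :
  measurable_fun setT m ->
  measurable_fun setT (fun p : T * 'rV[R]_d => (p.1, m p.1 + s *: p.2)%R).
Proof.
move=> mm; apply: measurable_fun_pair => //; apply: measurable_rowD.
  exact: (measurableT_comp mm measurable_fst).
by apply: measurable_rowZ; exact: measurable_snd.
Qed.

(** The identity of [is_cond_law] for E = Z^-1(A) says that (Z, Y) and (Z, m(Z) + sqrt(v) z), with z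
    an independent standard Gaussian, agree on rectangles. Hence their laws agree. *)
Lemma integral_gauss_cond_law (G : set (set Omega)) (Y : Omega -> 'rV[R]_d)
    (Z : Omega -> T) (m : T -> 'rV[R]_d) (v : R) :
  is_cond_law P G Y (fun w => gauss (m (Z w)) v) ->
  measurable_fun setT Y -> measurable_fun setT Z -> measurable_fun setT m ->
  (forall A, measurable A -> G (Z @^-1` A)) ->
  forall h : T * 'rV[R]_d -> \bar R,
  measurable_fun setT h -> (forall p, 0 <= h p) ->
  \int[P]_w h (Z w, Y w) =
  \int[P]_w \int[std_gauss R d]_z h (Z w, (m (Z w) + Num.sqrt v *: z)%R).
Proof.
move=> [_ PY] mY mZ mm GZ h mh h0.
pose PP : probability (Omega * 'rV[R]_d)%type R := (P \x std_gauss R d)%E.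
pose F (p : Omega * 'rV[R]_d) := (Z p.1, m (Z p.1) + Num.sqrt v *: p.2)%R.
have mF : measurable_fun setT F.
  have mZ' : measurable_fun setT (fun p : Omega * 'rV[R]_d => (Z p.1, p.2)).
    apply: measurable_fun_pair; last exact: measurable_snd.
    exact: (measurableT_comp mZ measurable_fst).
  exact: (measurableT_comp (measurable_gauss_step (Num.sqrt v) mm) mZ').
have mZY : measurable_fun setT (fun w => (Z w, Y w)) by exact: measurable_fun_pair.
have /= <- := fubini_tonelli1 (m1 := P) (m2 := std_gauss R d) (h \o F)
  (measurableT_comp mh mF) (fun=> h0 _).
apply: (ge0_integral_same_law (P := P) (Q := PP) mZY mF _ mh h0) => B mB.
apply: (eq_measure_rectangles (m1 := distribution P (mfun_of mZY))
  (m2 := distribution PP (mfun_of mF)) _ mB) => {B mB} A B mA mB.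
transitivity (P (Z @^-1` A `&` Y @^-1` B)); first by [].
rewrite PY//; last exact: GZ.
rewrite integral_mkcond; apply: eq_integral => w _; rewrite patchE /=.
case: ifPn => [/set_mem/= Aw|/negP Aw].
  congr (std_gauss R d _); apply/seteqP; split => z; rewrite /xsection/= inE /F/=.
    by [].
  by case.
rewrite (_ : xsection _ _ = set0) ?measure0//.
by rewrite -subset0 /xsection => z/=; rewrite inE /F/= => -[/mem_set].
Qed.

(** The value at x is the standard Gaussian measure of the section at x of a measurable subset [C]
    of the product. *)
Lemma measurable_gauss (m : T -> 'rV[R]_d) (v : R) B :
  measurable_fun setT m -> measurable B ->
  measurable_fun setT (fun x => gauss (m x) v B).
Proof.
move=> mm mB.
pose C := (fun p : T * 'rV[R]_d => m p.1 + Num.sqrt v *: p.2)%R @^-1` B.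
have mC : measurable C.
  apply: preimage_measurable mB.
  have := measurable_gauss_step (Num.sqrt v) mm.
  by move=> /measurable_fun_pairP[].
rewrite (_ : (fun x => _) = std_gauss R d \o xsection C).
  exact: measurable_fun_xsection.
apply/funext => x /=; congr (std_gauss R d _); apply/seteqP; split => z;
  by rewrite /xsection/= inE.
Qed.

End disintegration.

Lemma integral_prob_ecst d (T : measurableType d) (R : realType)
    (P : probability T R) (k : \bar R) : (\int[P]_w k = k)%E.
Proof. by rewrite integral_cst//= probability_setT mule1. Qed.

(** * Marginals and posterior of the forward chain *)

Section forward_posterior.
Local Open Scope ereal_scope.
Context {R : realType} {d : nat} {dO : measure_display}
  {Omega : measurableType dO}.
Variables (S : schedule R) (P : probability Omega R)
  (X : nat -> Omega -> 'rV[R]_d).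
Hypothesis fX : forward_chain S P X.
Local Notation V := 'rV[R]_d.
Local Notation gamma := (std_gauss R d).

Let mX k : (k <= nsteps S)%N -> measurable_fun setT (X k).
Proof. exact: fX.1. Qed.

(** The test function keeps x_0 besides x_k, since the posterior conditions on x_0. The past of the
    chain contains the events of this pair. *)
Lemma integral_forward_step k (h : (V * V) * V -> \bar R) :
  (k < nsteps S)%N -> measurable_fun setT h -> (forall p, 0 <= h p) ->
  \int[P]_w h ((X 0%N w, X k w), X k.+1 w) =
  \int[P]_w \int[gamma]_z h ((X 0%N w, X k w),
    (Num.sqrt (acoef S k.+1) *: X k w + Num.sqrt (bcoef S k.+1) *: z)%R).
Proof.
move=> kN mh h0.
pose Z w := (X 0%N w, X k w).
pose m (p : V * V) : V := (Num.sqrt (acoef S k.+1) *: p.2)%R.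
have mm : measurable_fun setT m by apply: measurable_rowZ; exact: measurable_snd.
have mZ : measurable_fun setT Z.
  by apply: measurable_fun_pair; apply: mX => //; exact: ltnW.
have := fX.2 k.+1 kN.
rewrite [X in fun w => gauss _ X](_ : _ = bcoef S k.+1); last first.
  by rewrite /acoef opprB addrC subrK.
move=> cl; apply: (integral_gauss_cond_law (Z := Z) (m := m) cl) => //.
  exact: mX.
move=> A mA; apply: (sigma_gen_preimage (T := (V * V)%type)) => //.
by apply: measurable_fun_pair; apply: measurable_sigma_gen_type => /=.
Qed.

(** The coefficients normalize the sum of the two noises in x_{k+1}; c^2 + s^2 = 1 is the identity a
    (1 - abar_k) + b = 1 - abar_{k+1}, for a and b at k + 1. For k = 0 one gets c = 0, while s stays
    positive. *)
Lemma reflection_coefs k : (k < nsteps S)%N ->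
  let c := (Num.sqrt (acoef S k.+1) * Num.sqrt (1 - abar S k) /
            Num.sqrt (1 - abar S k.+1))%R in
  let s := (Num.sqrt (bcoef S k.+1) / Num.sqrt (1 - abar S k.+1))%R in
  [/\ (0 < s)%R, (c ^+ 2 + s ^+ 2 = 1)%R,
     (Num.sqrt (acoef S k.+1) * Num.sqrt (1 - abar S k) =
        Num.sqrt (1 - abar S k.+1) * c)%R,
     (Num.sqrt (bcoef S k.+1) = Num.sqrt (1 - abar S k.+1) * s)%R &
     (0 < Num.sqrt (1 - abar S k.+1))%R].
Proof.
move=> kN c s; have k0N : (0 < k.+1 <= nsteps S)%N by [].
have q1 : (0 < 1 - abar S k.+1)%R by rewrite subr_gt0 abar_lt1.
have s1 : (0 < Num.sqrt (1 - abar S k.+1))%R by rewrite sqrtr_gt0.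
have /andP[b0 b1] := bcoef_itv (s := S) k0N.
have /andP[a0 a1] := acoef_itv k0N.
have /andP[p0 p1] := abar_itv (ltnW kN).
split => //.
- by rewrite divr_gt0 ?sqrtr_gt0.
- rewrite !expr_div_n exprMn !sqr_sqrtr ?(ltW b0) ?(ltW a0) ?(ltW q1) ?subr_ge0//.
  rewrite -mulrDl (_ : acoef S k.+1 * (1 - abar S k) + bcoef S k.+1 =
    1 - abar S k.+1)%R ?divff ?gt_eqF//.
  by rewrite abarS /acoef; ring.
- by rewrite /c [RHS]mulrC divfK// gt_eqF.
- by rewrite /s [RHS]mulrC divfK// gt_eqF.
Qed.

Lemma integral_forward_marginal k (h : V * V -> \bar R) : (k <= nsteps S)%N ->
  measurable_fun setT h -> (forall p, 0 <= h p) ->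
  \int[P]_w h (X 0%N w, X k w) =
  \int[P]_w \int[gamma]_z h (X 0%N w,
    (Num.sqrt (abar S k) *: X 0%N w + Num.sqrt (1 - abar S k) *: z)%R).
Proof.
elim: k h => [|k IH] h kN mh h0.
  apply: eq_integral => w _; rewrite abar0 subrr sqrtr1 sqrtr0.
  under eq_integral do rewrite scale1r scale0r addr0.
  exact/esym/integral_prob_ecst.
pose h' (p : (V * V) * V) := h (p.1.1, p.2).
have mh' : measurable_fun setT h'.
  apply: measurableT_comp => //; apply: measurable_fun_pair => //.
  exact: (measurableT_comp measurable_fst measurable_fst).
pose A := Num.sqrt (acoef S k.+1); pose B := Num.sqrt (bcoef S k.+1).
pose H (p : V * V) := \int[gamma]_z h (p.1, (A *: p.2 + B *: z)%R).
have mAB : measurable_fun setT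
    (fun q : (V * V) * V => h (q.1.1, (A *: q.1.2 + B *: q.2)%R)).
  apply: measurableT_comp => //; apply: measurable_fun_pair.
    exact: (measurableT_comp measurable_fst measurable_fst).
  apply: measurable_rowD; apply: measurable_rowZ => //.
  exact: (measurableT_comp measurable_snd measurable_fst).
have mH : measurable_fun setT H.
  exact: (measurable_fun_fubini_tonelli_F (m2 := gamma) _ mAB (fun=> h0 _)).
have H0 p : 0 <= H p by exact: integral_ge0.
apply: etrans (integral_forward_step (h := h') kN mh' (fun=> h0 _)) _.
apply: etrans (IH H (ltnW kN) mH H0) _.
have [s0 cs Ec Es sg] := reflection_coefs kN.
set c := (A * Num.sqrt (1 - abar S k) / _)%R in cs Ec.
set s := (B / _)%R in s0 cs Es.
apply: eq_integral => w _; rewrite /H /=.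
pose f (q : V * V) := h (X 0%N w,
  (Num.sqrt (abar S k.+1) *: X 0%N w + Num.sqrt (1 - abar S k.+1) *: q.1)%R).
have mf : measurable_fun setT f.
  apply: measurableT_comp => //; apply: measurable_fun_pair => //.
  apply: measurable_rowD => //; apply: measurable_rowZ; exact: measurable_fst.
(* [f] ignores its second argument, so a dummy Gaussian can be inserted. The reflection then splits
   the single noise into the noises of the two steps. *)
transitivity (\int[gamma]_x \int[gamma]_y f (x, y)); last first.
  by apply: eq_integral => z _; exact: (integral_prob_ecst gamma (f (z, 0%R))).
apply: etrans (ge0_integral_gauss_reflection s0 cs mf (fun=> h0 _)).
apply: eq_integral => z1 _; apply: eq_integral => z2 _.
rewrite /f; congr (h (_, _)).
rewrite /A /B scalerDr !scalerA Ec Es scalerDr !scalerA addrA; congr (_ *: _ + _ + _)%R.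
by rewrite abarS sqrtrM 1?mulrC//; case/andP: (abar_itv (ltnW kN)) => /ltW.
Qed.

(** The mean of [posterior] as a map on pairs (x_0, x_k), in this order, as measurability of the
    kernel requires. *)
Definition posterior_mean k (p : V * V) : V :=
  ((Num.sqrt (acoef S k))^-1 *:
    (p.2 - (bcoef S k / Num.sqrt (1 - abar S k)) *: noise_of S k p.2 p.1))%R.

Lemma measurable_posterior_mean k : measurable_fun setT (posterior_mean k).
Proof.
apply: measurable_rowZ; apply: measurable_rowB; first exact: measurable_snd.
apply: measurable_rowZ; apply: measurable_rowZ.
apply: measurable_rowB; first exact: measurable_snd.
by apply: measurable_rowZ; exact: measurable_fst.
Qed.

Lemma forward_posterior k : (0 < k <= nsteps S)%N ->
  is_cond_law P (sigma_gen X [set j | (j == 0)%N || (j == k)%N]) (X k.-1)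
    (fun w => posterior S k (X k w) (X 0%N w)).
Proof.
move=> /[dup] k0N /andP[k0 kN].
have mG : measurable_fun
    [set: sigma_gen_type X [set j | (j == 0)%N || (j == k)%N]]
    (fun w => (X 0%N w, X k w)).
  by apply: measurable_fun_pair; apply: measurable_sigma_gen_type;
    rewrite /= ?eqxx ?orbT.
split.
  move=> B U mB mU.
  have mK := measurable_gauss (btilde S k) (@measurable_posterior_mean k) mB.
  have mKU := preimage_measurable mK mU.
  exact: (sigma_gen_preimage mG mKU).
move=> E B GE mB.
(* The conditioning event is an event about the pair (x_0, x_k). *)
have [D mD ->] : exists2 D, measurable D & E = (fun w => (X 0%N w, X k w)) @^-1` D.
  apply: (sigma_gen_sub_preimage (T := (V * V)%type) _ GE) => j /= /orP[] /eqP ->.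
    by exists fst.
  by exists snd.
case: k k0 kN k0N mG GE => // k _ kN k0N mG GE /=.
have [s0 cs Ec Es sg] := reflection_coefs kN.
set A := Num.sqrt (acoef S k.+1) in Ec.
set B' := Num.sqrt (bcoef S k.+1) in Es.
set c := (A * Num.sqrt (1 - abar S k) / _)%R in cs Ec.
set s := (B' / _)%R in s0 cs Es.
set sg1 := Num.sqrt (1 - abar S k.+1) in Ec Es sg.
have mX0 : measurable_fun setT (X 0%N) by exact: mX.
have mXk : measurable_fun setT (X k) by apply: mX; exact: ltnW.
have mXk1 : measurable_fun setT (X k.+1) by exact: mX.
pose K (q : V * V) := gauss (posterior_mean k.+1 q) (btilde S k.+1) B.
have mK : measurable_fun setT K.
  exact: measurable_gauss (@measurable_posterior_mean k.+1) mB.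
have K0 q : 0 <= K q by [].
(* Arguments in the order of [integral_forward_step]: ((x_0, x_{k-1}), x_k), where the old index k
   has become [k.+1]. *)
pose h (q : (V * V) * V) : \bar R := (\1_D (q.1.1, q.2) * \1_B q.1.2)%:E.
have h0 q : 0 <= h q by rewrite lee_fin mulr_ge0.
have mh : measurable_fun setT h.
  apply/measurable_EFinP; apply: measurable_funM.
    apply: (measurableT_comp (measurable_indic mD)).
    apply: measurable_fun_pair => //.
    exact: (measurableT_comp measurable_fst measurable_fst).
  apply: (measurableT_comp (measurable_indic mB)).
  exact: (measurableT_comp measurable_snd measurable_fst).
transitivity (\int[P]_w h ((X 0%N w, X k w), X k.+1 w)).
  have mDB : measurable ((fun w => (X 0%N w, X k.+1 w)) @^-1` D `&` X k @^-1` B).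
    apply: measurableI; last exact: preimage_measurable.
    by apply: preimage_measurable => //; exact: measurable_fun_pair.
  apply: (@etrans _ _ (\int[P]_w (\1_((fun w => (X 0%N w, X k.+1 w)) @^-1` D `&`
    X k @^-1` B) w)%:E)); first by rewrite integral_indic// setIT.
  by apply: eq_integral => w _; rewrite indicI.
transitivity (\int[P]_w ((\1_D (X 0%N w, X k.+1 w))%:E *
    K (X 0%N w, X k.+1 w))); last first.
  rewrite [RHS]integral_mkcond; apply: eq_integral => w _; rewrite patchE indicE.
  have -> : (w \in (fun w => (X 0%N w, X k.+1 w)) @^-1` D) =
    ((X 0%N w, X k.+1 w) \in D) by apply/idP/idP; rewrite !inE.
  by case: ifPn => _; rewrite ?mul1e ?mul0e.
pose H (p : V * V) := \int[gamma]_z h (p, (A *: p.2 + B' *: z)%R).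
have mAB : measurable_fun setT
    (fun q : (V * V) * V => h (q.1, (A *: q.1.2 + B' *: q.2)%R)).
  apply: measurableT_comp => //; apply: measurable_fun_pair => //.
  apply: measurable_rowD; apply: measurable_rowZ => //.
  exact: (measurableT_comp measurable_snd measurable_fst).
have mH : measurable_fun setT H.
  exact: (measurable_fun_fubini_tonelli_F (m2 := gamma) _ mAB (fun=> h0 _)).
have H0 p : 0 <= H p by exact: integral_ge0.
apply: etrans (integral_forward_step kN mh h0) _.
apply: etrans (integral_forward_marginal (h := H) (ltnW kN) mH H0) _.
(* [G] is the integrand on the kernel side. Both sides are now integrals over x_0 and Gaussian
   noise: two noises for [h], one for [G]. *)
pose G (q : V * V) := (\1_D q : R)%:E * K q.
have mG' : measurable_fun setT G.
  apply: emeasurable_funM => //.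
  by apply/measurable_EFinP; exact: measurable_indic.
have G0 q : 0 <= G q by rewrite mule_ge0 ?lee_fin.
apply/esym; apply: etrans (integral_forward_marginal (h := G) kN mG' G0) _.
apply: eq_integral => w _; rewrite /H /=.
set x0 := X 0%N w; set M := (Num.sqrt (abar S k) *: x0)%R.
pose f (q : V * V) := h ((x0, (M + Num.sqrt (1 - abar S k) *: q.1)%R),
  (A *: (M + Num.sqrt (1 - abar S k) *: q.1) + B' *: q.2)%R).
have mf : measurable_fun setT f.
  apply: measurableT_comp => //.
  have mM : measurable_fun setT
      (fun q : V * V => (M + Num.sqrt (1 - abar S k) *: q.1)%R).
    apply: measurable_rowD => //; apply: measurable_rowZ; exact: measurable_fst.
  apply: measurable_fun_pair; first exact: measurable_fun_pair.
  apply: measurable_rowD; apply: measurable_rowZ => //; exact: measurable_snd.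
apply/esym; apply: etrans (esym (ge0_integral_gauss_reflection s0 cs mf (fun=> h0 _))) _.
apply: eq_integral => z1 _.
set W := (Num.sqrt (abar S k.+1) *: x0 + sg1 *: z1)%R.
have [p0 p1] : (0 < abar S k)%R /\ (abar S k <= 1)%R.
  by apply/andP; apply: abar_itv; exact: ltnW.
have [a0 a1] : (0 < acoef S k.+1)%R /\ (acoef S k.+1 < 1)%R.
  by apply/andP; exact: acoef_itv.
have [b0 b1] : (0 < bcoef S k.+1)%R /\ (bcoef S k.+1 < 1)%R.
  by apply/andP; exact: bcoef_itv.
have A0 : (0 < A)%R by rewrite sqrtr_gt0.
have A2 : (A ^+ 2 = acoef S k.+1)%R by rewrite sqr_sqrtr// ltW.
have sig2 : (Num.sqrt (1 - abar S k) ^+ 2 = 1 - abar S k)%R.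
  by rewrite sqr_sqrtr// subr_ge0.
have sg2 : (sg1 ^+ 2 = 1 - abar S k.+1)%R.
  by rewrite sqr_sqrtr// subr_ge0 ltW// abar_lt1.
have alphaE : (Num.sqrt (abar S k.+1) = A * Num.sqrt (abar S k))%R.
  by rewrite abarS sqrtrM 1?mulrC// ltW.
(* After the reflection x_{k+1} no longer depends on y: its noise is z1 alone, because c^2 + s^2 =
   1. *)
have WE y : (A *: (M + Num.sqrt (1 - abar S k) *: (c *: z1 + s *: y)) +
    B' *: (s *: z1 - c *: y) = W)%R.
  rewrite /W alphaE; apply/rowP => i; rewrite !mxE.
  transitivity (A * Num.sqrt (abar S k) * x0 ord0 i +
    (A * Num.sqrt (1 - abar S k)) * (c * z1 ord0 i + s * y ord0 i) +
    B' * (s * z1 ord0 i - c * y ord0 i))%R; first by ring.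
  rewrite Ec Es -[in RHS](mulr1 sg1) -cs; ring.
(* For fixed z1, x_k is affine in y. This identity and [sbE] match its constant term with the
   posterior mean and its slope with the posterior standard deviation. *)
have pmE : posterior_mean k.+1 (x0, W) =
    (M + (Num.sqrt (1 - abar S k) * c) *: z1)%R.
  rewrite /posterior_mean /noise_of /= -/sg1 -/A.
  have -> : (W - Num.sqrt (abar S k.+1) *: x0 = sg1 *: z1)%R.
    by rewrite /W addrC addKr.
  rewrite [(sg1^-1 *: _)%R]scalerA (mulVf (lt0r_neq0 sg)) scale1r /W alphaE.
  apply/rowP => i; rewrite !mxE.
  transitivity (Num.sqrt (abar S k) * x0 ord0 i +
     (sg1 ^+ 2 - bcoef S k.+1) / (A * sg1) * z1 ord0 i)%R.
    by field; rewrite !gt_eqF.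
  congr (_ + _ * _)%R; rewrite sg2 /c -/sg1.
  have -> : (1 - abar S k.+1 - bcoef S k.+1 =
      A ^+ 2 * Num.sqrt (1 - abar S k) ^+ 2)%R.
    by rewrite A2 sig2 abarS /acoef; ring.
  by field; rewrite !gt_eqF.
have sbE : Num.sqrt (btilde S k.+1) = (Num.sqrt (1 - abar S k) * s)%R.
  rewrite (_ : btilde _ _ = (Num.sqrt (1 - abar S k) * s) ^+ 2)%R.
    by rewrite sqrtr_sqr ger0_norm// mulr_ge0// ltW.
  rewrite exprMn sig2 expr_div_n sg2 sqr_sqrtr ?(ltW b0)//.
  by rewrite /btilde /= mulrAC mulrA.
transitivity (\int[gamma]_y ((\1_D (x0, W))%:E *
    (\1_((fun y => posterior_mean k.+1 (x0, W) +
       Num.sqrt (btilde S k.+1) *: y)%R @^-1` B) y)%:E)).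
  apply: eq_integral => y _; rewrite /f /h /= WE -EFinM pmE sbE !indicE.
  rewrite scalerDr !scalerA addrA.
  set u := (_ \in B); set v := (y \in _); suff -> : u = v by [].
  by apply/idP/idP => /set_mem ?; exact/mem_set.
have mpre : measurable ((fun y => posterior_mean k.+1 (x0, W) +
    Num.sqrt (btilde S k.+1) *: y)%R @^-1` B).
  by apply: preimage_measurable => //; exact: measurable_shift_scale.
rewrite ge0_integralZl//; last exact/measurable_EFinP/measurable_indic.
by rewrite /G /K; congr (_ * _); rewrite integral_indic// setIT.
Qed.

End forward_posterior.

(** * Wiener integrals *)

Section L2cvg.
Context d (T : measurableType d) (R : realType).
Variables (mu : {measure set T -> \bar R}) (D : set T).
Hypothesis mD : measurable D.
Implicit Types (X : T -> R) (Y : nat -> T -> R).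

Definition L2cvg X Y : Prop :=
  [/\ measurable_fun D X, forall n, measurable_fun D (Y n),
      forall n, mu.-integrable D (fun x => (Y n x ^+ 2)%:E) &
      (\int[mu]_(x in D) ((X x - Y n x) ^+ 2)%:E)%E @[n --> \oo] --> 0%E].

(** A sequence tending to 0 is eventually finite, so some X - Y_n is square-integrable; then X = (X
    - Y_n) + Y_n. *)
Lemma L2cvg_integrable X Y : L2cvg X Y ->
  mu.-integrable D (fun x => (X x ^+ 2)%:E).
Proof.
move=> [mX mY iY XY].
have mXY n : measurable_fun D (fun x => X x - Y n x) by exact: measurable_funB.
have [n nlt] : exists n, (\int[mu]_(x in D) ((X x - Y n x) ^+ 2)%:E < +oo)%E.
  have [N _ /(_ N (leqnn N)) h] := cvg_is_fine XY.
  by exists N; rewrite ltey_eq h.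
have iXY : mu.-integrable D (fun x => ((X x - Y n x) ^+ 2)%:E).
  apply/integrableP; split; first by apply/measurable_EFinP/measurable_funX.
  under eq_integral do rewrite gee0_abs ?lee_fin ?sqr_ge0//.
  exact: nlt.
have := integrable_sqrD mD (mXY n) (mY n) iXY (iY n).
by apply: eq_integrable => // x _; rewrite subrK.
Qed.

Lemma L2cvg_sqr X Y : L2cvg X Y ->
  \int[mu]_(x in D) (Y n x ^+ 2) @[n --> \oo] --> \int[mu]_(x in D) (X x ^+ 2).
Proof.
move=> /[dup] /L2cvg_integrable iX [mX mY iY XY].
have mXY n : measurable_fun D (fun x => X x - Y n x) by exact: measurable_funB.
have iXY n : mu.-integrable D (fun x => ((X x - Y n x) ^+ 2)%:E).
  have := integrable_sqrD mD mX _ iX (integrable_sqrZ mD (-1) (iY n)).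
  move=> /(_ (measurable_funM (measurable_cst _) (mY n))).
  by apply: eq_integrable => // x _; rewrite mulN1r.
pose A := \int[mu]_(x in D) (X x ^+ 2).
have A0 : 0 <= A by apply: Rintegral_ge0 => x _; exact: sqr_ge0.
pose e n := \int[mu]_(x in D) ((X x - Y n x) ^+ 2).
have e0 : e n @[n --> \oo] --> (0 : R) by exact: fine_cvg XY.
(* |X^2 - Y^2| <= (X - Y)^2 + 2 |X - Y| |X|, then Young's inequality with
   parameter l for the last term *)
have bound n (l : R) : 0 < l ->
    `|A - \int[mu]_(x in D) (Y n x ^+ 2)| <= (1 + l^-1) * e n + l * A.
  move=> l0; rewrite /A /e -(RintegralB mD iX (iY n)).
  have iB := integrableB mD iX (iY n).
  apply: (le_trans (le_normr_Rintegral mD iB)).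
  have i1 := integrableZl mD (1 + l^-1) (iXY n).
  have i2 := integrableZl mD l iX.
  apply: (@le_trans _ _ (\int[mu]_(x in D)
      ((1 + l^-1) * (X x - Y n x) ^+ 2 + l * X x ^+ 2))); last first.
    by rewrite RintegralD// (RintegralZl _ mD (iXY n)) (RintegralZl _ mD iX).
  apply: le_Rintegral => //.
  - exact: (integrable_norm iB).
  - exact: (integrableD mD i1 i2).
  move=> x _; set u := X x; set y := Y n x.
  have il : 0 < l^-1 by rewrite invr_gt0.
  have ll : l * l^-1 = 1 by rewrite mulfV// gt_eqF.
  (* The two squares give both signs of 2 |u - y| |u| <= l^-1 (u - y)^2 + l u^2. *)
  have h1 : 0 <= l^-1 * ((u - y) - l * u) ^+ 2 by rewrite mulr_ge0 ?sqr_ge0// ltW.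
  have h2 : 0 <= l^-1 * ((u - y) + l * u) ^+ 2 by rewrite mulr_ge0 ?sqr_ge0// ltW.
  have E1 : l^-1 * ((u - y) - l * u) ^+ 2 =
     l^-1 * (u - y) ^+ 2 - 2 * (l * l^-1) * (u - y) * u + (l * l^-1) * l * u ^+ 2.
    by ring.
  have E2 : l^-1 * ((u - y) + l * u) ^+ 2 =
     l^-1 * (u - y) ^+ 2 + 2 * (l * l^-1) * (u - y) * u + (l * l^-1) * l * u ^+ 2.
    by ring.
  rewrite E1 ll in h1; rewrite E2 ll in h2.
  have E3 : u ^+ 2 - y ^+ 2 = 2 * (u - y) * u - (u - y) ^+ 2 by ring.
  rewrite E3 ler_norml mulrDl mul1r.
  by have h3 := sqr_ge0 (u - y); apply/andP; split; lra.
apply/cvgrPdist_lt => eps eps0.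
(* This makes l A < eps / 2; the added 1 keeps the denominator positive when A = 0. The other half
   of eps is left for the term in [e n]. *)
pose l := eps / (2 * (A + 1)).
have l0 : 0 < l by rewrite divr_gt0// mulr_gt0// ltr_wpDl.
have lA : l * A < eps / 2.
  rewrite /l -mulrA ltr_pM2l// mulrC ltr_pdivrMr ?mulr_gt0 ?ltr_wpDl//.
  by rewrite mulrA mulVf ?mul1r ?pnatr_eq0// ltrDl.
pose k := 1 + l^-1.
have k0 : 0 < k by rewrite addr_gt0// invr_gt0.
have : \forall n \near \oo, `|0 - e n| < eps / 2 / k.
  by move/cvgrPdist_lt : e0; apply; rewrite !divr_gt0.
apply: filterS => n; rewrite sub0r normrN => en.
apply: le_lt_trans (bound n l l0) _.
have : k * e n < eps / 2.
  by rewrite mulrC -ltr_pdivlMr//; exact: le_lt_trans (ler_norm _) en.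
by rewrite -/k; lra.
Qed.

Lemma L2cvgD X X' Y Y' : L2cvg X Y -> L2cvg X' Y' ->
  L2cvg (fun x => X x + X' x) (fun n x => Y n x + Y' n x).
Proof.
move=> [mX mY iY XY] [mX' mY' iY' XY']; split.
- exact: measurable_funD.
- by move=> n; exact: measurable_funD.
- by move=> n; exact: integrable_sqrD.
(* The squeezing bound comes from (a + b)^2 <= 2 (a^2 + b^2). *)
have h : ((2%:E * (\int[mu]_(x in D) ((X x - Y n x) ^+ 2)%:E +
     \int[mu]_(x in D) ((X' x - Y' n x) ^+ 2)%:E)) @[n --> \oo] --> 0)%E.
  have d00 : ((0 : \bar R) +? 0)%E by [].
  have := cvgeZl (y := 2%:E) isT (cvgeD d00 XY XY').
  by rewrite adde0 mule0; exact.
apply: (squeeze_cvge _ (cvg_cst _) h).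
apply: nearW => n; rewrite integral_ge0//=; last by move=> x _; rewrite lee_fin sqr_ge0.
have mXY : measurable_fun D (fun x => ((X x - Y n x) ^+ 2)%:E).
  by apply/measurable_EFinP/measurable_funX/measurable_funB.
have mXY' : measurable_fun D (fun x => ((X' x - Y' n x) ^+ 2)%:E).
  by apply/measurable_EFinP/measurable_funX/measurable_funB.
rewrite -ge0_integralD//; [|by move=> x _; rewrite lee_fin sqr_ge0..].
rewrite -ge0_integralZl//; first last.
- by move=> x _; rewrite adde_ge0// lee_fin sqr_ge0.
- exact: emeasurable_funD.
apply: ge0_le_integral => //.
- by move=> x _; rewrite lee_fin sqr_ge0.
- apply/measurable_EFinP/measurable_funX; apply: measurable_funB;
  exact: measurable_funD.
- by apply: emeasurable_funM => //; exact: emeasurable_funD.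
move=> x _; rewrite -EFinD -EFinM lee_fin.
have -> : X x + X' x - (Y n x + Y' n x) = (X x - Y n x) + (X' x - Y' n x) by ring.
have := sqr_ge0 ((X x - Y n x) - (X' x - Y' n x)).
by rewrite sqrrB sqrrD; lra.
Qed.

Lemma L2cvgM X X' Y Y' : L2cvg X Y -> L2cvg X' Y' ->
  \int[mu]_(x in D) (Y n x * Y' n x) @[n --> \oo] -->
  \int[mu]_(x in D) (X x * X' x).
Proof.
move=> c c'; have cD := L2cvgD c c'.
have [mX mY iY _] := c; have [mX' mY' iY' _] := c'.
have pol (f g : T -> R) : measurable_fun D f -> measurable_fun D g ->
    mu.-integrable D (fun x => (f x ^+ 2)%:E) ->
    mu.-integrable D (fun x => (g x ^+ 2)%:E) ->
    \int[mu]_(x in D) (f x * g x) =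
    2^-1 * (\int[mu]_(x in D) ((f x + g x) ^+ 2) -
      \int[mu]_(x in D) (f x ^+ 2) - \int[mu]_(x in D) (g x ^+ 2)).
  move=> mf mg jf jg; have jfg := integrable_sqrD mD mf mg jf jg.
  have j1 := integrableB mD jfg jf.
  have j2 := integrableB mD j1 jg.
  rewrite -(RintegralB mD jfg jf) -(RintegralB mD j1 jg) -(RintegralZl _ mD j2).
  by apply: eq_Rintegral => x _; field.
rewrite pol//; [|exact: L2cvg_integrable c|exact: L2cvg_integrable c'].
under eq_fun do rewrite pol//.
apply: cvgM; first exact: cvg_cst.
by apply: cvgB; [apply: cvgB|]; exact: L2cvg_sqr.
Qed.

End L2cvg.

(** * Step functions, independent increments and the isometry *)

Section step_functions.
Context {R : realType}.
Local Notation mu := (@lebesgue_measure R).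

Lemma measurable_step_fun n (s c : nat -> R) D :
  measurable D -> measurable_fun D (step_fun n s c).
Proof.
move=> mD; apply: (measurable_funS measurableT) => //.
by apply: measurable_sum => i; apply: measurable_funM.
Qed.

Lemma step_times_le n (s : nat -> R) i j :
  (forall i, (i < n)%N -> s i <= s i.+1) -> (i <= j <= n)%N -> s i <= s j.
Proof.
move=> sS; elim: j => [|j IH]; first by rewrite leqn0 => /andP[/eqP ->].
move=> /andP[]; rewrite leq_eqVlt => /predU1P[-> //|ij jn].
by apply: le_trans (sS j jn); apply: IH; rewrite -ltnS ij ltnW.
Qed.

Lemma step_funS n (s c : nat -> R) u :
  step_fun n.+1 s c u = step_fun n s c u + c n * \1_(`]s n, s n.+1]) u.
Proof. by rewrite /step_fun big_ord_recr. Qed.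

(** The intervals ]s_i, s_{i+1}] are disjoint, so the cross terms vanish. Having [s n <= b] rather
    than an equality lets the induction stay on the same [a, b]. *)
Lemma integral_step_fun_sqr n (s c : nat -> R) (a b : R) :
  (forall i, (i < n)%N -> s i <= s i.+1) -> a <= s 0%N -> s n <= b ->
  (\int[mu]_(u in `[a, b]) (step_fun n s c u ^+ 2)%:E =
  (\sum_(i < n) c i ^+ 2 * (s i.+1 - s i))%:E)%E.
Proof.
move=> + as0; elim: n b => [|n IH] b sS snb.
  rewrite big_ord0; apply: integral0_eq => u _.
  by rewrite /step_fun big_ord0 expr0n.
have sS' i : (i < n)%N -> s i <= s i.+1 by move=> /ltnW; exact: sS.
have snS : s n <= s n.+1 by apply: sS.
have asn : a <= s n.
  apply: le_trans (step_times_le (n := n) (i := 0) (j := n) sS' _) => //.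
  by rewrite leqnn.
have disj u : step_fun n s c u * (c n * \1_(`]s n, s n.+1]) u) = 0.
  rewrite indicE; have [/set_mem/=|_] := boolP (u \in _); last by rewrite !mulr0.
  rewrite in_itv/= => /andP[snu _].
  rewrite /step_fun big1 ?mul0r// => i _.
  rewrite indicE memNset ?mulr0//= in_itv/= => /andP[_].
  apply/negP; rewrite -ltNge; apply: le_lt_trans snu.
  by apply: (step_times_le (n := n)) => //; rewrite ltn_ord leqnn.
transitivity (\int[mu]_(u in `[a, b]) ((step_fun n s c u ^+ 2)%:E +
    (c n ^+ 2)%:E * (\1_(`]s n, s n.+1]) u)%:E))%E.
  apply: eq_integral => u _; rewrite step_funS -EFinM -EFinD; congr EFin.
  rewrite sqrrD disj mul0rn addr0 exprMn; congr (_ + _ * _).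
  by rewrite indicE; case: (_ \in _); rewrite ?expr1n ?expr0n.
rewrite ge0_integralD//; last 4 first.
- by move=> u _; rewrite lee_fin sqr_ge0.
- by apply/measurable_EFinP/measurable_funX; exact: measurable_step_fun.
- by move=> u _; rewrite -EFinM lee_fin mulr_ge0 ?sqr_ge0.
- apply: emeasurable_funM => //.
  by apply/measurable_EFinP; exact: measurable_indic.
rewrite IH//; last exact: le_trans snb.
rewrite ge0_integralZl//; last 2 first.
- by apply/measurable_EFinP; exact: measurable_indic.
- by rewrite lee_fin sqr_ge0.
rewrite integral_indic// (_ : _ `&` _ = `]s n, s n.+1]%classic); last first.
  apply/setIidPl => u /=; rewrite !in_itv/= => /andP[h1 h2].
  by rewrite (le_trans asn (ltW h1)) (le_trans h2).
rewrite /= lebesgue_measure_itv/= lte_fin big_ord_recr EFinD; congr (_ + _)%E.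
move: snS; rewrite le_eqVlt => /predU1P[<-|->]; last by rewrite -EFinM.
by rewrite ltxx subrr mule0 mulr0.
Qed.

Lemma integrable_step_fun_sqr n (s c : nat -> R) (a b : R) :
  (forall i, (i < n)%N -> s i <= s i.+1) -> a <= s 0%N -> s n <= b ->
  mu.-integrable `[a, b] (fun u => (step_fun n s c u ^+ 2)%:E).
Proof.
move=> sS as0 snb; apply/integrableP; split.
  by apply/measurable_EFinP/measurable_funX; exact: measurable_step_fun.
under eq_integral do rewrite gee0_abs ?lee_fin ?sqr_ge0//.
by rewrite integral_step_fun_sqr// ltry.
Qed.

End step_functions.

Section independence.
Local Open Scope ereal_scope.
Context {R : realType} {d : nat} {dO : measure_display}
  {Omega : measurableType dO}.
Variables (P : probability Omega R) (G : set (set Omega))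
  (Y : Omega -> 'rV[R]_d) (Q : probability 'rV[R]_d R).
Hypotheses (mY : measurable_fun setT Y) (cl : is_cond_law P G Y (fun=> Q)).

(** A constant conditional law means independence: (U, Y) has the product law, first on rectangles,
    then everywhere. *)
Lemma integral_cond_law_indep (U : Omega -> R) (f : 'rV[R]_d -> R) :
  measurable_fun setT U -> (forall A, measurable A -> G (U @^-1` A)) ->
  measurable_fun setT f ->
  P.-integrable setT (fun w => (U w)%:E) ->
  Q.-integrable setT (fun y => (f y)%:E) ->
  \int[P]_w (U w * f (Y w))%:E =
  \int[P]_w (U w)%:E * \int[Q]_y (f y)%:E.
Proof.
move=> mU GU mf iU iF; rewrite -(integral_prodM iU iF).2.
pose PQ : probability (Omega * 'rV[R]_d)%type R := (P \x Q)%E.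
have mUY : measurable_fun setT (fun w => (U w, Y w)) by exact: measurable_fun_pair.
have mF : measurable_fun setT (fun p : Omega * 'rV[R]_d => (U p.1, p.2)).
  apply: measurable_fun_pair; last exact: measurable_snd.
  exact: (measurableT_comp mU measurable_fst).
have law (B : set (R * 'rV[R]_d)) : measurable B -> P ((fun w => (U w, Y w)) @^-1` B) =
    PQ ((fun p : Omega * 'rV[R]_d => (U p.1, p.2)) @^-1` B).
  move=> mB.
  apply: (eq_measure_rectangles (m1 := distribution P (mfun_of mUY))
    (m2 := distribution PQ (mfun_of mF)) _ mB) => {B mB} A B mA mB.
  transitivity (P (U @^-1` A) * Q B).
    transitivity (P (U @^-1` A `&` Y @^-1` B)); first by [].
    rewrite cl.2//; last exact: GU.
    rewrite integral_cst//; last exact: preimage_measurable.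
    by rewrite muleC.
  rewrite -product_measure1E//; exact: preimage_measurable.
have mh : measurable_fun setT (fun q : R * 'rV[R]_d => (q.1 * f q.2)%R).
  apply: measurable_funM => //.
  exact: (measurableT_comp mf measurable_snd).
exact: (integral_same_law (P := P) (Q := PQ) mUY mF law mh (integral_prodM iU iF).1).2.
Qed.

Lemma cond_law_cst B : G setT -> measurable B -> P (Y @^-1` B) = Q B.
Proof.
move=> GT mB; rewrite -[in LHS](setTI (Y @^-1` B)) cl.2// integral_cst//=.
by rewrite probability_setT mule1.
Qed.

End independence.

Section wiener.
Local Open Scope ereal_scope.
Context {R : realType} {d : nat} {dO : measure_display}
  {Omega : measurableType dO}.
Variables (P : probability Omega R) (W : R -> Omega -> 'rV[R]_d).
Hypothesis bW : brownian_motion P W.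
Local Open Scope ring_scope.

Lemma isotropic_increment s u : 0 <= s -> s < u ->
  isotropic P (fun w => W u w - W s w) 0 (u - s).
Proof.
move=> s0 su; have [mW _ inc _] := bW.
have u0 : 0 <= u by exact: le_trans (ltW su).
have mY : measurable_fun setT (fun w => W u w - W s w).
  by apply: measurable_rowB; apply: mW.
apply: (isotropic_same_law mY _ (isotropic_gauss 0 (v := u - s) _)).
  move=> B mB; apply: (cond_law_cst (inc s u s0 su)) => //.
  exact: (@measurableT _ (sigma_gen_type W [set r | 0 <= r <= s])).
by rewrite subr_ge0 ltW.
Qed.

Lemma isotropicD (Y D : Omega -> 'rV[R]_d) (v u c : R) :
  isotropic P Y 0 v -> isotropic P D 0 u ->
  (forall i j, (\int[P]_w (Y w ord0 i * D w ord0 j)%:E = 0)%E) ->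
  isotropic P (fun w => Y w + c *: D w) 0 (v + c ^+ 2 * u).
Proof.
move=> iY iD YD; have [mY Y2 EY EYY] := iY; have [mD D2 ED EDD] := iD.
have E w i : (Y w + c *: D w) ord0 i = Y w ord0 i + c * D w ord0 i by rewrite !mxE.
have jY i := isotropic_integrable i iY.
have jD i := isotropic_integrable i iD.
have jYY i j := isotropic_integrableM i j iY.
have jDD i j := isotropic_integrableM i j iD.
have jYD i j : P.-integrable setT (fun w => (Y w ord0 i * D w ord0 j)%:E).
  by apply: integrable_mul_sqr => //; exact: measurable_row_entry.
split.
- by apply: measurable_rowD => //; exact: measurable_rowZ.
- move=> i; under eq_fun do rewrite E.
  apply: integrable_sqrD => //.
  + exact: measurable_row_entry.
  + by apply: measurable_funM => //; exact: measurable_row_entry.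
  + exact: integrable_sqrZ.
- move=> i; under eq_integral do rewrite E EFinD EFinM.
  rewrite integralD//=; last exact: integrableZl.
  by rewrite integralZl// EY ED !mxE mule0 adde0.
- move=> i j.
  transitivity (\int[P]_w ((Y w ord0 i * Y w ord0 j)%:E +
     (c%:E * (Y w ord0 i * D w ord0 j)%:E + (c%:E * (Y w ord0 j * D w ord0 i)%:E
      + (c ^+ 2)%:E * (D w ord0 i * D w ord0 j)%:E))))%E.
    apply: eq_integral => w _; rewrite !E -!EFinM -!EFinD; congr EFin; ring.
  rewrite integralD//=; last first.
    apply: integrableD => //; first exact: integrableZl.
    by apply: integrableD => //; exact: integrableZl.
  rewrite integralD//=; [|exact: integrableZl|]; last first.
    by apply: integrableD => //; exact: integrableZl.
  rewrite integralD//=; [|exact: integrableZl..].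
  rewrite !integralZl// !YD EYY EDD mule0 !add0e -!EFinM -!EFinD !mxE; congr EFin.
  by case: (i == j); rewrite ?mulr1n ?mulr0n; ring.
Qed.

Lemma isotropic_step_integral n (s c : nat -> R) :
  0 <= s 0%N -> (forall i, (i < n)%N -> s i <= s i.+1) ->
  isotropic P (step_integral W n s c) 0 (\sum_(i < n) c i ^+ 2 * (s i.+1 - s i)).
Proof.
move=> s0; have [mW _ inc _] := bW.
elim: n => [|n IH] sS.
  rewrite big_ord0 (_ : step_integral _ _ _ _ = fun=> 0); last first.
    by apply/funext => w; rewrite /step_integral big_ord0.
  split => //.
  - move=> i; under eq_fun do rewrite mxE expr0n.
    exact: (finite_measure_integrable_cst P 0).
  - by move=> i; rewrite integral_prob_cst.
  - by move=> i j; rewrite integral_prob_cst mul0rn addr0.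
have sS' i : (i < n)%N -> s i <= s i.+1 by move=> /ltnW; exact: sS.
have sn0 i : (i <= n)%N -> 0 <= s i.
  by move=> ni; apply: le_trans s0 _; exact: (step_times_le sS').
have EY : step_integral W n.+1 s c =
    fun w => step_integral W n s c w + c n *: (W (s n.+1) w - W (s n) w).
  by apply/funext => w; rewrite /step_integral big_ord_recr.
rewrite big_ord_recr/=.
(* Nodes may coincide, whereas [brownian_motion] gives the law of an increment only for s < u; an
   empty step adds nothing. *)
have := sS n (ltnSn n); rewrite le_eqVlt => /predU1P[ss|ss].
  rewrite EY -ss subrr mulr0 addr0.
  rewrite (_ : (fun _ => _) = step_integral W n s c); first exact: IH.
  by apply/funext => w; rewrite subrr scaler0 addr0.
rewrite EY; have iY := IH sS'; have [mY _ EY0 _] := iY.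
apply: isotropicD => //.
  by apply: isotropic_increment => //; exact: sn0.
move=> i j.
have iD := isotropic_increment (sn0 n (leqnn n)) ss.
have snn := ltW ss.
have iG := isotropic_gauss (0 : 'rV[R]_d) (v := s n.+1 - s n).
have {}iG : isotropic (gauss 0 (s n.+1 - s n)) id (0 : 'rV[R]_d) (s n.+1 - s n).
  by apply: iG; rewrite subr_ge0.
(* The sum over earlier steps belongs to the past at time s n, hence is independent of the next
   increment, and the cross moments vanish. *)
have mG : measurable_fun
    [set: sigma_gen_type W [set r | 0 <= r <= s n]]
    (fun w => step_integral W n s c w ord0 i).
  apply: measurable_row_entry; rewrite /step_integral.
  (* The number of terms is separated from n so that the induction runs under the fixed
     sigma-algebra of times up to s n. *)
  pose f m (w : Omega) := \sum_(i < m) c i *: (W (s i.+1) w - W (s i) w).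
  have f0 : f 0%N = fun=> 0 by apply/funext => w; rewrite /f big_ord0.
  have fS m : f m.+1 = fun w => f m w + c m *: (W (s m.+1) w - W (s m) w).
    by apply/funext => w; rewrite /f big_ord_recr.
  suff : forall m, (m <= n)%N -> measurable_fun
      [set: sigma_gen_type W [set r | 0 <= r <= s n]] (f m).
    by move=> /(_ n (leqnn n)).
  elim=> [|m IHm] mn; first by rewrite f0.
  rewrite fS; apply: measurable_rowD; first exact: IHm (ltnW mn).
  apply: measurable_rowZ; apply: measurable_rowB;
    apply: measurable_sigma_gen_type => /=; rewrite sn0 ?(ltnW mn)//=;
    by apply: (step_times_le sS'); rewrite ?mn ?leqnn ?(ltnW mn).
have := integral_cond_law_indep (Y := fun w => W (s n.+1) w - W (s n) w)
  (Q := gauss 0 (s n.+1 - s n)) (U := fun w => step_integral W n s c w ord0 i)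
  (f := fun y => y ord0 j) _ (inc _ _ (sn0 n (leqnn n)) ss).
move=> -> //.
- by rewrite EY0 mxE mul0e.
- by apply: measurable_rowB; apply: mW; [exact: le_trans (sn0 n (leqnn n)) _|exact: sn0].
- exact: measurable_row_entry.
- by move=> A mA; exact: (sigma_gen_preimage mG mA).
- exact: measurable_coord.
- exact: isotropic_integrable iY.
- exact: isotropic_integrable iG.
Qed.

Lemma isotropic_limit (Y : nat -> Omega -> 'rV[R]_d) (vs : nat -> R)
    (I : Omega -> 'rV[R]_d) v :
  (forall m, isotropic P (Y m) 0 (vs m)) -> measurable_fun setT I ->
  (forall j, (\int[P]_w ((I w ord0 j - Y m w ord0 j) ^+ 2)%:E)%E
     @[m --> \oo] --> 0%E) ->
  vs m @[m --> \oo] --> v -> isotropic P I 0 v.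
Proof.
move=> iY mI YI vsv.
have c1 j : L2cvg P setT (fun w => I w ord0 j) (fun m w => Y m w ord0 j).
  split.
  - exact: measurable_row_entry.
  - by move=> n; have [mY _ _ _] := iY n; exact: measurable_row_entry.
  - by move=> n; have [_ + _ _] := iY n; exact.
  - exact: YI.
(* pairing with the constant 1 yields the convergence of the means *)
have cc : L2cvg P setT (fun=> 1) (fun _ _ => 1).
  split => //.
  - by move=> n; exact: (finite_measure_integrable_cst P (1 ^+ 2)).
  - under eq_fun do rewrite subrr expr0n integral_prob_cst.
    exact: cvg_cst.
have iI j := L2cvg_integrable measurableT (c1 j).
split => //.
- move=> i.
  have := L2cvgM measurableT (c1 i) cc.
  have -> : (fun n => \int[P]_x (Y n x ord0 i * 1)) = fun=> 0.
    apply/funext => n; rewrite /Rintegral; under eq_integral do rewrite mulr1.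
    by have [_ _ -> _] := iY n; rewrite mxE.
  have iIi : P.-integrable setT (fun w => (I w ord0 i)%:E).
    apply: (@integrable_sqr _ _ _ P (fun w => I w ord0 i)) => //.
    exact: measurable_row_entry.
  move=> /(cvg_unique (@norm_hausdorff _ _) (cvg_cst 0)) E.
  rewrite mxE E /Rintegral; under [X in (fine X)%:E]eq_integral do rewrite mulr1.
  by rewrite fineK//; exact: integrable_fin_num.
- move=> i j.
  have := L2cvgM measurableT (c1 i) (c1 j).
  have -> : (fun n => \int[P]_x (Y n x ord0 i * Y n x ord0 j)) =
      fun n => vs n *+ (i == j).
    apply/funext => n; rewrite /Rintegral.
    by have [_ _ _ ->] := iY n; rewrite !mxE mul0r add0r.
  have iIij : P.-integrable setT (fun w => (I w ord0 i * I w ord0 j)%:E).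
    by apply: integrable_mul_sqr => //; exact: measurable_row_entry.
  have vij : vs n *+ (i == j) @[n --> \oo] --> v *+ (i == j).
    by case: (i == j); rewrite ?mulr1n ?mulr0n//; exact: cvg_cst.
  move=> /(cvg_unique (@norm_hausdorff _ _) vij) E.
  rewrite !mxE mul0r add0r E /Rintegral fineK//; exact: integrable_fin_num.
Qed.

Lemma isotropic_wiener_integral (phi : R -> R) (a b : R)
    (I : Omega -> 'rV[R]_d) :
  0 <= a -> is_wiener_integral P W phi a b I ->
  isotropic P I 0 (\int[lebesgue_measure]_(u in `[a, b]) phi u ^+ 2).
Proof.
move=> a0 [mphi mI [n [s [c [sab phic Ic]]]]].
apply: (isotropic_limit (vs := fun m =>
  \sum_(i < n m) c m i ^+ 2 * (s m i.+1 - s m i)) _ mI Ic).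
  move=> m; have [s0 _ sS] := sab m.
  by apply: isotropic_step_integral => //; rewrite s0.
(* The variance of a step integral is the Lebesgue integral of the squared step function, so the
   variances converge by the same L^2 argument on [a, b]. *)
have c2 : L2cvg lebesgue_measure `[a, b] phi
    (fun m => step_fun (n m) (s m) (c m)).
  split => //.
  - by move=> m; exact: measurable_step_fun.
  - move=> m; have [s0 s1 sS] := sab m.
    by apply: integrable_step_fun_sqr => //; rewrite ?s0 ?s1.
have mab : measurable (`[a, b]%classic : set (measurableTypeR R)).
  exact: measurable_itv.
have := L2cvg_sqr mab c2; apply: cvg_trans; apply: near_eq_cvg.
apply: nearW => m; have [s0 s1 sS] := sab m.
by rewrite /Rintegral integral_step_fun_sqr// ?s0 ?s1.
Qed.

End wiener.

(** * Comparison of the two backward steps *)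

Section exponential_bounds.
Context {R : realType}.
Implicit Types t h : R.

Lemma le_of_ge0_derive (f df : R -> R) t : 0 <= t ->
  (forall x : R, is_derive x 1 f (df x)) -> (forall x, 0 < x < t -> 0 <= df x) ->
  f 0 <= f t.
Proof.
move=> t0 fdf df0.
have dr (x : R) : derivable f x 1 by have [] := fdf x.
apply: (@ger0_derive1_le_cc _ f 0 t) => //.
- move=> x; rewrite in_itv/= => xt; rewrite derive1E.
  by have [_ ->] := fdf x; exact: df0.
- apply: derivable_within_continuous => x _; exact: dr.
- by rewrite in_itv/= lexx.
- by rewrite in_itv/= lexx andbT.
Qed.

(** From 1 - t <= exp(-t) follows exp(t) <= 1 / (1 - t), so the remainder is at most t^2 / (1 - t);
    the constant 2 is 1 / (1 - t) at t = 1/2. *)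
Lemma expRB1_le t : 0 <= t <= 2^-1 -> expR t - 1 - t <= 2 * t ^+ 2.
Proof.
move=> /andP[t0 t1]; have := expR_ge1Dx (- t); rewrite expRN => h.
have e0 := expR_gt0 t.
have eV : expR t * (expR t)^-1 = 1 by rewrite mulfV// gt_eqF.
have : (1 - t) * expR t <= 1.
  by rewrite -[leRHS]eV mulrC ler_pM2l.
by nra.
Qed.

(** The function is 2 sinh t - 2 t, with derivative exp(-t) (exp(t) - 1)^2. On the interval exp(t) -
    1 <= 2 t, so the derivative lies between 0 and 4 t^2, below 6 t^2, the derivative of 2 t^3. *)
Lemma sinh_bounds t : 0 <= t <= 2^-1 ->
  0 <= expR t - expR (- t) - 2 * t <= 2 * t ^+ 3.
Proof.
move=> /andP[t0 t1].
pose f x : R := expR x - expR (- x) - 2 * x.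
pose df x : R := expR x + expR (- x) - 2.
have fdf (x : R) : is_derive x 1 f (df x).
  apply: is_derive_eq; rewrite /df /GRing.scale/=; ring.
have dfE x : df x = expR (- x) * (expR x - 1) ^+ 2.
  have e1 : expR (- x) * expR x = 1 by rewrite mulrC expRxMexpNx_1.
  transitivity ((expR (- x) * expR x) * expR x - 2 * (expR (- x) * expR x) +
    expR (- x)).
    by rewrite e1 /df; ring.
  by ring.
have f0 : f 0 = 0 by rewrite /f oppr0 mulr0 !subrr.
apply/andP; split.
  have := le_of_ge0_derive t0 fdf; rewrite f0; apply => x _.
  by rewrite dfE mulr_ge0 ?expR_ge0 ?sqr_ge0.
pose k x : R := 2 * x ^+ 3 - f x.
have kdk (x : R) : is_derive x 1 k (6 * x ^+ 2 - df x).
  apply: is_derive_eq; rewrite /GRing.scale/=; ring.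
have k0 : k 0 = 0 by rewrite /k f0 expr0n mulr0 subrr.
rewrite -subr_ge0 -/(f t) -/(k t) -k0.
apply: le_of_ge0_derive => // x /andP[x0 xt]; rewrite dfE.
have xh : 0 <= x <= 2^-1 by apply/andP; split; lra.
have h1 := expRB1_le xh.
have h2 := expR_ge1Dx x.
have h3 : expR (- x) <= 1 by rewrite expR_le1; lra.
have h4 : 0 < expR (- x) by exact: expR_gt0.
have h5 : 0 <= expR x - 1 <= 2 * x by apply/andP; split; nra.
have h6 : (expR x - 1) ^+ 2 <= (2 * x) ^+ 2.
  by case/andP: h5 => h5 h7; rewrite ler_pXn2r// nnegrE//; lra.
have h7 : 0 <= (expR x - 1) ^+ 2 by exact: sqr_ge0.
by nra.
Qed.

(** From exp(h) >= 1 + h one gets 1 - exp(-h) >= h / (1 + h), and 1 + h <= 2. *)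
Lemma onem_expRN_ge h : 0 <= h <= 1 -> h / 2 <= 1 - expR (- h).
Proof.
move=> /andP[h0 h1]; rewrite expRN; have := expR_ge1Dx h => h2.
have e0 := expR_gt0 h.
have eV : expR h * (expR h)^-1 = 1 by rewrite mulfV// gt_eqF.
have : (1 + h) * (expR h)^-1 <= 1 by rewrite -[leRHS]eV ler_pM2r ?invr_gt0.
have : 0 < (expR h)^-1 by rewrite invr_gt0.
by nra.
Qed.

End exponential_bounds.

(** * The VP correspondence over one step *)

Section vp_facts.
Context {R : realType}.
Variables (S : schedule R) (alpha sigma f g : R -> R).
Hypothesis vp : vp_corr S alpha sigma f g.
Variable k : nat.
Hypothesis kN : (0 < k <= nsteps S)%N.
Local Notation mu := (@lebesgue_measure R).
Local Notation h := (hstep S alpha k).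
Local Notation D := (`[tgrid S k.-1, tgrid S k]%classic).

(** Positivity is read off from b_k > 0, as beta itself is only known to be nonnegative. *)
Lemma hstep_gt0 : 0 < h.
Proof.
have /andP[b0 _] := bcoef_itv kN.
by move: b0; rewrite (vp_b vp kN) subr_gt0 expR_lt1 oppr_lt0.
Qed.

Lemma tgrid_le i j : (i <= j <= nsteps S)%N -> tgrid S i <= tgrid S j.
Proof.
by apply: step_times_le => l lN; exact/ltW/tgrid_lt.
Qed.

Lemma step_sub01 u : tgrid S k.-1 <= u <= tgrid S k -> 0 <= u <= 1.
Proof.
have [k0 kn] : (0 < k)%N /\ (k <= nsteps S)%N by apply/andP.
move=> /andP[u1 u2]; apply/andP; split.
  by apply: le_trans u1; rewrite -(tgrid0 S) tgrid_le//= (leq_trans (leq_pred _)).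
by apply: le_trans u2 _; rewrite -(tgridN S) tgrid_le// kn leqnn.
Qed.

Lemma btilde_le_bcoef : btilde S k <= bcoef S k.
Proof.
case: k kN => // n nN.
have /andP[p0 p1] : 0 < abar S n <= 1 by apply: abar_itv; exact: ltnW.
have q1 := abar_lt1 nN; have /andP[b0 b1] := bcoef_itv nN.
rewrite /btilde /= ler_piMl ?(ltW b0)// ler_pdivrMr ?subr_gt0// mul1r.
by rewrite abarS /acoef; nra.
Qed.

Lemma btilde_lt_hstep : btilde S k < h.
Proof.
apply: le_lt_trans btilde_le_bcoef _; rewrite (vp_b vp kN).
have := @expR_gt1Dx R (- h); rewrite oppr_eq0 gt_eqF ?hstep_gt0// => /(_ isT).
by lra.
Qed.

(** This comes with [em_noise], in reversed time, and is the source of the measurability of beta on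
    the step. *)
Hypothesis mg : measurable_fun `[1 - tgrid S k, 1 - tgrid S k.-1]
  (fun tau => g (1 - tau)).

(* On the step, beta is the square of the integrand of the stochastic term. *)
Lemma measurable_beta_step : measurable_fun D (beta alpha).
Proof.
have mon : measurable_fun D (fun u : R => 1 - u) by exact: measurable_funB.
have /measurable_funX : measurable_fun D ((fun tau => g (1 - tau)) \o (fun u => 1 - u)).
  apply: (measurable_comp _ _ mg mon); first exact: measurable_itv.
  move=> _ [u /= + <-]; rewrite !in_itv/= => /andP[u1 u2].
  by apply/andP; split; lra.
move=> /(_ 2%N); apply: eq_measurable_fun => u /set_mem/=; rewrite in_itv/= => uD.
by rewrite subKr (vp_g vp)// step_sub01.
Qed.

Lemma beta_step_ge0 u : D u -> 0 <= beta alpha u.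
Proof. by rewrite /= in_itv/= => uD; rewrite (vp_beta vp)// step_sub01. Qed.

(* [fine +oo = 0], hence h > 0 forces the extended integral to be finite. *)
Lemma integral_beta_step : (\int[mu]_(u in D) (beta alpha u)%:E = h%:E)%E.
Proof.
have i0 : (0 <= \int[mu]_(u in D) (beta alpha u)%:E)%E.
  by apply: integral_ge0 => u uD; rewrite lee_fin beta_step_ge0.
have := hstep_gt0; rewrite /hstep /Rintegral.
by move: i0; case: (\int[mu]_(u in _) _)%E => [r| |]//=; rewrite ltxx.
Qed.

Lemma integrable_beta_step : mu.-integrable D (EFin \o beta alpha).
Proof.
apply/integrableP; split.
  by apply/measurable_EFinP; exact: measurable_beta_step.
rewrite [X in (X < _)%E](_ : _ = h%:E) ?ltry// -integral_beta_step.
by apply: eq_integral => u /set_mem uD /=; rewrite ger0_norm// beta_step_ge0.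
Qed.

(** This is the variance of the Euler-Maruyama noise. The substitution u = 1 - tau undoes the time
    reversal. *)
Lemma Rintegral_sqr_reversed :
  \int[mu]_(u in `[1 - tgrid S k, 1 - tgrid S k.-1]) g (1 - u) ^+ 2 = h.
Proof.
rewrite /Rintegral -[RHS]/(fine h%:E) -integral_beta_step; congr fine.
rewrite [RHS](@ge0_integral_affine _ (-1) 1)//; last 2 first.
- by apply/measurable_EFinP; exact: measurable_beta_step.
- by move=> u uD; rewrite lee_fin beta_step_ge0.
rewrite normrN1 mul1e.
have -> : (fun x : R => -1 * x + 1) @^-1` D =
    `[1 - tgrid S k, 1 - tgrid S k.-1]%classic.
  apply/seteqP; split => u /=; rewrite !in_itv/= => /andP[u1 u2].
    by apply/andP; split; lra.
  by apply/andP; split; lra.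
apply: eq_integral => u /set_mem/=; rewrite in_itv/= => /andP[u1 u2].
have -> : -1 * u + 1 = 1 - u by ring.
by rewrite (vp_g vp)// step_sub01//; apply/andP; split; lra.
Qed.

(** Both running coefficients are multiples of beta, so the drift with frozen state is beta times a
    constant. *)
Lemma integral_rev_drift d (eps : 'rV[R]_d -> R -> 'rV[R]_d) (x : 'rV[R]_d) i :
  \int[mu]_(s in D) rev_drift f g sigma eps s (tgrid S k) x ord0 i =
  h * (- (1 / 2) * x ord0 i + (sigma (tgrid S k))^-1 * eps x (tgrid S k) ord0 i).
Proof.
set c := - (1 / 2) * x ord0 i + _.
transitivity (\int[mu]_(s in D) (beta alpha s * c)).
  apply: eq_Rintegral => s /set_mem/=; rewrite in_itv/= => sD.
  rewrite /rev_drift !mxE (vp_f vp) ?(vp_g vp) ?step_sub01//.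
  by rewrite /c; ring.
by rewrite RintegralZr//; exact: integrable_beta_step.
Qed.

End vp_facts.

Section em_comparison.
Context {R : realType} {d : nat}.
Variables (S : schedule R) (alpha sigma f g : R -> R)
  (eps : 'rV[R]_d -> R -> 'rV[R]_d).
Hypothesis vp : vp_corr S alpha sigma f g.
Variable k : nat.
Hypothesis kN : (0 < k <= nsteps S)%N.
Local Notation h := (hstep S alpha k).

(** The mean of [em_step] with no O(h^2) remainder, because f and g^2 are integrated over the step
    instead of being frozen. *)
Definition em_mean (x : 'rV[R]_d) : 'rV[R]_d :=
  x + h *: (2^-1 *: x - (Num.sqrt (1 - abar S k))^-1 *: eps x (tgrid S k)).

Section em_law.
Context {dO : measure_display} {Omega : measurableType dO}.
Variables (P : probability Omega R) (W : R -> Omega -> 'rV[R]_d)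
  (I : Omega -> 'rV[R]_d).
Hypotheses (bW : brownian_motion P W) (eI : em_noise S g k P W I).

Lemma isotropic_em_noise : isotropic P I 0 h.
Proof.
have [mg _ _] := eI; rewrite -(Rintegral_sqr_reversed vp kN mg).
apply: (isotropic_wiener_integral bW _ eI).
rewrite subr_ge0; have /andP[] // : 0 <= tgrid S k <= 1.
by apply: (step_sub01 kN); rewrite lexx tgrid_le// leq_pred; case/andP: kN.
Qed.

Lemma isotropic_em_step x :
  isotropic P (em_step S f g sigma eps k x I) (em_mean x) h.
Proof.
have [mg _ _] := eI.
have := isotropic_affine (em_mean x) 1 isotropic_em_noise.
rewrite scaler0 addr0 expr1n mul1r; congr (isotropic P _ _ _).
apply/funext => w; rewrite scale1r /em_step; congr (_ + _).
apply/rowP => i; rewrite !mxE (integral_rev_drift vp kN mg).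
have [k0 kn] : (0 < k)%N /\ (k <= nsteps S)%N by apply/andP.
by rewrite (vp_sigma vp kn); ring.
Qed.

End em_law.

Lemma isotropic_ddpm_kernel x :
  isotropic (ddpm_kernel S eps k x) id (ddpm_mean S eps k x) (btilde S k).
Proof. by apply: isotropic_gauss; exact: btilde_ge0. Qed.

(* The coefficient of eps is (2 sinh (h/2) - h) / sigma_k = O(h^3) / sigma_k,
   and sigma_k >= h/2, so that the bound is uniform in k. *)
Lemma ddpm_mean_em_mean x : h < 1 ->
  `|ddpm_mean S eps k x - em_mean x| <=
  2^-1 * (`|x| + `|eps x (tgrid S k)|) * h ^+ 2.
Proof.
move=> h1; have h0 := hstep_gt0 vp kN.
have [k0 kn] : (0 < k)%N /\ (k <= nsteps S)%N by apply/andP.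
set e := eps x _; set sg := Num.sqrt (1 - abar S k).
have aE : (Num.sqrt (acoef S k))^-1 = expR (h / 2).
  rewrite (vp_a vp kN) (_ : - h = - (h / 2) + - (h / 2)); last by field.
  rewrite expRD -expr2 sqrtr_sqr ger0_norm ?expR_ge0//.
  by rewrite expRN invrK.
have abar_le : abar S k <= acoef S k.
  case: k kN => // n nN.
  have /andP[p0 p1] : 0 < abar S n <= 1 by apply: abar_itv; exact: ltnW.
  have /andP[a0 a1] := acoef_itv nN.
  by rewrite abarS; nra.
have /andP[p0 p1] := abar_itv kn.
have bE := vp_b vp kN.
have hb : h / 2 <= bcoef S k by rewrite bE onem_expRN_ge// !ltW.
(* As sg <= 1, it dominates its square 1 - abar_k, which is at least b_k since abar_k <= a_k. *)
have sg_ge : h / 2 <= sg.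
  have q1 : bcoef S k <= 1 - abar S k by move: abar_le; rewrite /acoef; lra.
  have sg2 : sg ^+ 2 = 1 - abar S k by rewrite sqr_sqrtr// subr_ge0.
  have sg1 : sg <= 1.
    rewrite /sg -[leRHS]sqrtr1 ler_sqrt//; lra.
  have sg0 : 0 <= sg by exact: sqrtr_ge0.
  by nra.
have sg0 : 0 < sg by apply: lt_le_trans sg_ge; rewrite divr_gt0.
have y0 : 0 <= h / 2 <= 2^-1 by apply/andP; split; lra.
have /andP[B1 B2] := sinh_bounds y0.
have B3 := expRB1_le y0.
have B4 := expR_ge1Dx (h / 2).
(* Here 1 / sqrt(a) = exp(h/2) and b / sqrt(a) = exp(h/2) - exp(-h/2). Subtracting 1 + h/2 and h
   leaves the coefficients of x and, up to 1 / sg, of eps. *)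
pose u := expR (h / 2) - 1 - h / 2.
pose v := sg^-1 * (expR (h / 2) - expR (- (h / 2)) - 2 * (h / 2)).
have -> : ddpm_mean S eps k x - em_mean x = u *: x - v *: e.
  rewrite /ddpm_mean /em_mean aE bE -/sg -/e.
  have -> : expR (- h) = expR (- (h / 2)) * expR (- (h / 2)).
    by rewrite -expRD; congr expR; field.
  have eV : expR (h / 2) * expR (- (h / 2)) = 1 by rewrite expRxMexpNx_1.
  apply/rowP => i; rewrite !mxE /u /v.
  transitivity (expR (h / 2) * x ord0 i - (expR (h / 2) -
     (expR (h / 2) * expR (- (h / 2))) * expR (- (h / 2))) * sg^-1 * e ord0 i
     - (x ord0 i + h * (2^-1 * x ord0 i - sg^-1 * e ord0 i))); first by ring.
  by rewrite eV; field; rewrite gt_eqF.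
(* The constant 1/2 comes from 2 (h/2)^2 here, and below from 2 (h/2)^3 divided by the lower bound
   h/2 of sg. *)
have u_le : `|u| <= 2^-1 * h ^+ 2.
  rewrite /u ger0_norm; last by lra.
  by apply: le_trans B3 _; rewrite le_eqVlt; apply/orP; left; apply/eqP; field.
have v_le : `|v| <= 2^-1 * h ^+ 2.
  rewrite /v ger0_norm; last by rewrite mulr_ge0// invr_ge0 ltW.
  rewrite mulrC ler_pdivrMr//; apply: le_trans B2 _.
  have -> : 2 * (h / 2) ^+ 3 = 2^-1 * h ^+ 2 * (h / 2) by field.
  by rewrite ler_wpM2l// mulr_ge0 ?sqr_ge0// invr_ge0.
apply: le_trans (ler_normB _ _) _; rewrite [`|u *: _|]normrZ [`|v *: _|]normrZ.
have -> : 2^-1 * (`|x| + `|e|) * h ^+ 2 =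
  2^-1 * h ^+ 2 * `|x| + 2^-1 * h ^+ 2 * `|e| by ring.
by apply: lerD; apply: ler_wpM2r.
Qed.

End em_comparison.

(** Split h - btilde into (h - b) + (b - btilde). The first part is at most h^2; the second equals
    abar b^2 / (v + abar b), with abar at k - 1, and is at most h^2 / v. *)
Lemma btilde_first_order (R : realType) (S : schedule R)
    (alpha sigma f g : R -> R) k v :
  vp_corr S alpha sigma f g -> (0 < k <= nsteps S)%N -> 0 < v ->
  1 - abar S k.-1 = v -> hstep S alpha k < 2^-1 ->
  `|btilde S k - hstep S alpha k| <= (2 + v^-1) * hstep S alpha k ^+ 2.
Proof.
case: k => [|n]; first by rewrite ltnn.
move=> vp nN v0 /= vE h1; have h0 := hstep_gt0 vp nN.
have lt := btilde_lt_hstep vp nN.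
rewrite ltr0_norm ?subr_lt0// opprB.
have [b0 b1] : 0 < bcoef S n.+1 /\ bcoef S n.+1 < 1 by apply/andP; exact: bcoef_itv.
have bE := vp_b vp nN; move: h0 h1 lt bE.
set h := hstep _ _ _; set b := bcoef S n.+1 => h0 h1 lt bE.
have bh : b <= h by have := expR_ge1Dx (- h); lra.
(* Since 1 - b = exp(-h) <= 1 / (1 + h), the difference is at most h^2 / (1 + h). *)
have hb : h - b <= h ^+ 2.
  have := expR_ge1Dx h; have := expR_gt0 h.
  have : expR h * expR (- h) = 1 by rewrite expRxMexpNx_1.
  have -> : expR (- h) = 1 - b by lra.
  by nra.
have [p0 p1] : 0 < abar S n /\ abar S n <= 1.
  by apply/andP; apply: abar_itv; exact: ltnW.
have qE : 1 - abar S n.+1 = v + abar S n * b by rewrite abarS /acoef -vE -/b; ring.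
have pb0 : 0 <= abar S n * b by rewrite mulr_ge0// ltW.
have q0 : 0 < v + abar S n * b by rewrite ltr_pwDl.
have bbE : b - btilde S n.+1 = abar S n * b ^+ 2 / (v + abar S n * b).
  by rewrite /btilde /= vE qE -/b; field; rewrite gt_eqF.
have bb : b - btilde S n.+1 <= v^-1 * b ^+ 2.
  rewrite bbE ler_pdivrMr//.
  have -> : v^-1 * b ^+ 2 * (v + abar S n * b) =
    b ^+ 2 + v^-1 * (b ^+ 2 * (abar S n * b)) by field; rewrite gt_eqF.
  apply: ler_wpDr; first by rewrite mulr_ge0 ?invr_ge0 ?(ltW v0)// mulr_ge0// sqr_ge0.
  by rewrite ler_piMl// sqr_ge0.
have b2h : v^-1 * b ^+ 2 <= v^-1 * h ^+ 2.
  by rewrite ler_pM2l ?invr_gt0// ler_pXn2r// nnegrE ltW.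
have := sqr_ge0 h; rewrite mulrDl; lra.
Qed.

Theorem theorem7p7 (R : realType) (d : nat) (hd : (0 < d)%N) :
  (* 1. The Gaussian posterior is exact for the forward chain, and DDPM
        sampling is the reverse chain that it induces through eps. *)
  ((forall (S : schedule R) (dO : measure_display) (Omega : measurableType dO)
      (P : probability Omega R) (X : nat -> Omega -> 'rV[R]_d),
      forward_chain S P X ->
      forall k : nat, (0 < k <= nsteps S)%N ->
      is_cond_law P (sigma_gen X [set j | (j == 0)%N || (j == k)%N]) (X k.-1)
        (fun w => posterior S k (X k w) (X 0%N w))) /\
   (forall (S : schedule R) (eps : 'rV[R]_d -> R -> 'rV[R]_d)
      (dO : measure_display) (Omega : measurableType dO)
      (P : probability Omega R) (X : nat -> Omega -> 'rV[R]_d),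
      ddpm_sampling S eps P X <-> learned_reverse_chain S eps P X)) /\
  (* 2. Comparison with the backward Euler-Maruyama step. *)
  ((* conditional means agree up to O(h_k^2) *)
   (exists C delta : R, 0 < delta /\
      forall (S : schedule R) (alpha sigma f g : R -> R)
        (eps : 'rV[R]_d -> R -> 'rV[R]_d)
        (dO : measure_display) (Omega : measurableType dO)
        (P : probability Omega R) (W : R -> Omega -> 'rV[R]_d)
        (k : nat) (I : Omega -> 'rV[R]_d),
      vp_corr S alpha sigma f g ->
      brownian_motion P W ->
      (0 < k <= nsteps S)%N ->
      em_noise S g k P W I ->
      hstep S alpha k < delta ->
      forall x : 'rV[R]_d,
        `| mean_vec (ddpm_kernel S eps k x) id
           - mean_vec P (em_step S f g sigma eps k x I) |
        <= C * (`|x| + `|eps x (tgrid S k)|) * hstep S alpha k ^+ 2) /\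
   (* the stochastic terms differ at every step, DDPM having the exact
      posterior variance instead of the Euler-Maruyama one *)
   (forall (S : schedule R) (alpha sigma f g : R -> R)
        (eps : 'rV[R]_d -> R -> 'rV[R]_d)
        (dO : measure_display) (Omega : measurableType dO)
        (P : probability Omega R) (W : R -> Omega -> 'rV[R]_d)
        (k : nat) (I : Omega -> 'rV[R]_d),
      vp_corr S alpha sigma f g ->
      brownian_motion P W ->
      (0 < k <= nsteps S)%N ->
      em_noise S g k P W I ->
      [/\ forall x : 'rV[R]_d,
            cov_mx P (em_step S f g sigma eps k x I) = (hstep S alpha k)%:M,
          forall x x0 : 'rV[R]_d,
            cov_mx (ddpm_kernel S eps k x) id = (btilde S k)%:M /\
            cov_mx (posterior S k x x0) id = (btilde S k)%:M,
          btilde S k != hstep S alpha k &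
          forall x : 'rV[R]_d, exists2 B : set 'rV[R]_d, measurable B &
            P (I @^-1` B) <>
            ddpm_kernel S eps k x
              [set y | B (y - mean_vec (ddpm_kernel S eps k x) id)]]) /\
   (* first-order agreement of the variances for interior steps *)
   (forall v : R, 0 < v ->
      exists C delta : R, 0 < delta /\
      forall (S : schedule R) (alpha sigma f g : R -> R) (k : nat),
      vp_corr S alpha sigma f g ->
      (0 < k <= nsteps S)%N ->
      1 - abar S k.-1 = v ->
      hstep S alpha k < delta ->
      `| btilde S k - hstep S alpha k | <= C * hstep S alpha k ^+ 2)).
Proof.
split; [split|split; [|split]].
- by move=> S dO Omega P X fX k kN; exact: forward_posterior.
- move=> S eps dO Omega P X; split => -[mX lawN cl];
    (split; [exact: mX|exact: lawN|move=> k kN]).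
    have := cl k kN; congr (is_cond_law P _ _ _).
    by apply/funext => w; exact: ddpm_kernelE.
  have := cl k kN; congr (is_cond_law P _ _ _).
  by apply/funext => w; apply/esym; exact: ddpm_kernelE.
- exists 2^-1, 1; split => //.
  move=> S alpha sigma f g eps dO Omega P W k I vp bW kN eI h1 x.
  rewrite (isotropic_mean_vec (isotropic_ddpm_kernel eps kN x)).
  rewrite (isotropic_mean_vec (isotropic_em_step eps vp kN bW eI x)).
  exact: (ddpm_mean_em_mean eps vp kN x h1).
- move=> S alpha sigma f g eps dO Omega P W k I vp bW kN eI.
  have lt := btilde_lt_hstep vp kN; split.
  + by move=> x; rewrite (isotropic_cov_mx (isotropic_em_step eps vp kN bW eI x)).
  + move=> x x0; split; first exact: isotropic_cov_mx (isotropic_ddpm_kernel eps kN x).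
    by apply: isotropic_cov_mx; apply: isotropic_gauss; exact: btilde_ge0.
  + by rewrite lt_eqF.
  (* If no measurable set separated the two centred noises, they would have the same law, hence the
     same covariance. *)
  + move=> x; apply: contrapT => nB.
    have iK := isotropic_ddpm_kernel eps kN x.
    set Q := ddpm_kernel S eps k x in nB iK.
    set m := mean_vec Q id in nB.
    have iC := isotropic_affine (- m) 1 iK.
    have iI := isotropic_em_noise vp kN bW eI.
    have [mI _ _ _] := iI.
    have law B : measurable B ->
        P (I @^-1` B) = Q ((fun y => - m + 1 *: y) @^-1` B).
      move=> mB; apply: contrapT => ne; apply: nB; exists B => //.
      rewrite (_ : [set y | _] = (fun y => - m + 1 *: y) @^-1` B)//.
      by apply/seteqP; split => y /=; rewrite scale1r addrC.
    have := isotropic_cov_mx (isotropic_same_law mI law iC).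
    rewrite (isotropic_cov_mx iI) expr1n mul1r.
    (* A diagonal entry, available because d > 0, turns this into h = btilde. *)
    move=> /matrixP /(_ (Ordinal hd) (Ordinal hd)); rewrite !mxE eqxx !mulr1n.
    by move=> hE; move: lt; rewrite hE ltxx.
- move=> v v0; exists (2 + v^-1), 2^-1; split; first by rewrite invr_gt0.
  by move=> S alpha sigma f g k vp kN vE h1; exact: (btilde_first_order vp kN v0 vE h1).
Qed.
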